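(* There exists a graph on four vertices such that it is not possible on a radical computation tree to construct the coordinates of every possible Kamada and Kawai equilibrium of the graph.
   Context: Points of the plane are identified with complex numbers. An algebraic computation tree is a rooted tree whose computation nodes compute a value as the sum, difference, product or quotient of integer constants and values computed at ancestor nodes, and whose decision nodes test whether a previously computed value is greater than zero and branch accordingly. A radical computation tree additionally allows computing the $k$-th root of a previously computed value ($k$ an integer parameter) and complex conjugation. Kamada--Kawai model (constants $L=K=1$): for a connected graph with vertex positions $p_i$, the energy is $E=\sum_i\sum_{j>i}\frac12 k_{ij}(|p_i-p_j|-\ell_{ij})^2$ where $d_{ij}$ is the graph-theoretic distance between $v_i$ and $v_j$, $\ell_{ij}=d_{ij}$ and $k_{ij}=1/d_{ij}^2$; a Kamada and Kawai equilibrium is a drawing at which $E$ is at a local minimum. *)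

(* Defs.v *)
From mathcomp Require Import all_boot all_order all_algebra.
From mathcomp Require Import complex Rstruct.
From Stdlib Require Import Reals.

Set Implicit Arguments.
Unset Strict Implicit.
Unset Printing Implicit Defensive.

Import Order.TTheory GRing.Theory Num.Theory.
Local Open Scope ring_scope.

Notation RR := Rdefinitions.R.
Notation CC := (complex RR).

Definition cnorm (z : CC) : RR := Num.sqrt (complex.Re z ^+ 2 + complex.Im z ^+ 2).

Definition simple_graph (T : finType) (e : rel T) : Prop :=
  (forall x y, e x y = e y x) /\ (forall x, ~~ e x x).

Fixpoint walk (T : finType) (e : rel T) (n : nat) (i j : T) : bool :=
  match n with
  | 0 => i == j
  | n'.+1 => [exists k, e i k && walk e n' k j]
  end.

Definition connected_graph (T : finType) (e : rel T) : Prop :=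
  forall i j, exists n, walk e n i j.

(* graph-theoretic distance: least n such that there is a walk of length n
   (for a connected graph this is < #|T|) *)
Definition gdist (T : finType) (e : rel T) (i j : T) : nat :=
  find (fun n => walk e n i j) (iota 0 #|T|).

(* ---------- Kamada--Kawai model (L = K = 1) ---------- *)
Definition kk_energy (n : nat) (e : rel 'I_n) (p : 'I_n -> CC) : RR :=
  \sum_(i < n) \sum_(j < n | ltn i j)
     let d := (gdist e i j)%:R : RR in
     (1 / 2) * (1 / d ^+ 2) * (cnorm (p i - p j) - d) ^+ 2.

Definition kk_equilibrium (n : nat) (e : rel 'I_n) (p : 'I_n -> CC) : Prop :=
  exists eps : RR, 0 < eps /\
    forall q : 'I_n -> CC, (forall i, cnorm (q i - p i) < eps) ->
      kk_energy e p <= kk_energy e q.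

(* operations of computation nodes; natural-number arguments refer to
   values computed at ancestor nodes, numbered in order of computation *)
Inductive rop : Type :=
  | OConst of int
  | OAdd of nat & nat
  | OSub of nat & nat
  | OMul of nat & nat
  | ODiv of nat & nat
  | ORoot of nat & nat    (* ORoot k a : a k-th root of value a *)
  | OConj of nat.

Inductive rtree : Type :=
  | RLeaf of seq nat
  | RComp of rop & rtree
  | RDec of nat & rtree & rtree.

Inductive rop_val (vals : seq CC) : rop -> CC -> Prop :=
  | rv_const z : rop_val vals (OConst z) (z%:~R)
  | rv_add a b : rop_val vals (OAdd a b) (nth 0 vals a + nth 0 vals b)
  | rv_sub a b : rop_val vals (OSub a b) (nth 0 vals a - nth 0 vals b)
  | rv_mul a b : rop_val vals (OMul a b) (nth 0 vals a * nth 0 vals b)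
  | rv_div a b : nth 0 vals b != 0 ->
      rop_val vals (ODiv a b) (nth 0 vals a / nth 0 vals b)
  | rv_root k a y : ltn 0 k -> y ^+ k = nth 0 vals a ->
      rop_val vals (ORoot k a) y
  | rv_conj a : rop_val vals (OConj a) (conjc (nth 0 vals a)).

Inductive rtree_eval : seq CC -> rtree -> seq CC -> Prop :=
  | re_leaf vals outs :
      rtree_eval vals (RLeaf outs) [seq nth 0 vals i | i <- outs]
  | re_comp vals o v t out :
      rop_val vals o v -> rtree_eval (rcons vals v) t out ->
      rtree_eval vals (RComp o t) out
  | re_dec_pos vals i t1 t2 out :
      0 < nth 0 vals i -> rtree_eval vals t1 out ->
      rtree_eval vals (RDec i t1 t2) out
  | re_dec_neg vals i t1 t2 out :
      ~~ (0 < nth 0 vals i) -> rtree_eval vals t2 out ->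
      rtree_eval vals (RDec i t1 t2) out.

Definition rtree_constructs (n : nat) (t : rtree) (q : 'I_n -> CC) : Prop :=
  exists out, rtree_eval [::] t out /\ size out = n /\
    forall i : 'I_n, q i = nth 0 out i.

Definition congruent (n : nat) (p q : 'I_n -> CC) : Prop :=
  forall i j, cnorm (q i - q j) = cnorm (p i - p j).

(* Main.v *)
(* The graph is the paw, a triangle [0 1 2] with a pendant edge [2 3].  At an
   equilibrium symmetric under exchanging 0 and 1, the spring forces form a
   self-stress of four points in the plane, hence a multiple of the rank-one form
   [|c q0 + c q1 + m q2 + n q3|^2] with [2 c + m + n = 0]; when it is positive the
   equilibrium is a global minimum of the energy.  The lengths are determined by [m]
   and [n], and eliminating [n] shows that [6 m] is a root of a monic integer
   polynomial [f] of degree 14.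

   Frobenius elements at 89, 67 and 113 act on the roots of [f] as a 14-cycle, a
   13-cycle, and (after taking the 11th power) a transposition, so the Galois group
   contains all transpositions.  In a finite Galois extension of the rationals a number
   obtained by field operations and k-th roots is fixed by some term of the derived
   series: roots of unity are fixed by the first derived subgroup, and each further
   root costs one more step.  Since a 3-cycle is a commutator of 3-cycles, every term of
   the derived series moves every root of [f].  Finally conjugation maps radical
   numbers to radical numbers, so distances between radical points are radical. *)
Require Import Defs.
From HB Require Import structures.
From Stdlib Require Import ZArith.
From mathcomp Require Import all_boot all_order all_fingroup all_algebra all_solvable all_field.
From mathcomp Require Import boolp.
From mathcomp Require classical_sets.
From mathcomp Require Import complex Rstruct.
From mathcomp Require Import zify ssrZ ring lra.
Set Implicit Arguments.
Unset Strict Implicit.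
Unset Printing Implicit Defensive.
Import Order.TTheory GRing.Theory Num.Theory.
Local Open Scope ring_scope.
Delimit Scope Z_scope with ZZ.

(** * Frobenius elements of Galois groups *)

Section ResidueField.
Import classical_sets.
Local Open Scope quotient_scope.

(* Zorn's lemma is applied to sets enlarged by the multiples of [a], so that the
   empty chain has an upper bound too. *)
Lemma maximal_ideal_exists (R : comNzRingType) (a : R) :
  (forall r, a * r <> 1) ->
  exists I : R -> Prop,
    [/\ I a, forall x y, I x -> I y -> I (x + y), forall r x, I x -> I (r * x),
        ~ I 1 & forall z, ~ I z -> exists2 x, I x & exists r, x + z * r = 1].
Proof.
move=> aNunit.
pose gen (A : set R) (x : R) := A x \/ exists r, x = a * r.
pose ideal (A : set R) := [/\ forall x y, A x -> A y -> A (x + y),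
  forall r x, A x -> A (r * x) & ~ A 1].
have [A [[AD AM A1] Amax]] :
    exists A, ideal (gen A) /\ forall B, (A `<` B)%classic -> ~ ideal (gen B).
  apply: (@Zorn_bigcup R (fun A => ideal (gen A))) => F FP Ftot; split.
  - move=> x y; have lift X z : F X -> gen X z -> gen (\bigcup_(X in F) X)%classic z.
      by move=> FX [Xz|az]; [left; exists X | right].
    case=> [[X FX Xx]|[r ->]]; case=> [[Y FY Yy]|[s ->]].
    + have [XY|YX] := Ftot _ _ FX FY.
        by apply: (lift Y) => //; have [D _ _] := FP _ FY; apply: D; left => //; apply: XY.
      by apply: (lift X) => //; have [D _ _] := FP _ FX; apply: D; left => //; apply: YX.
    + by apply: (lift X) => //; have [D _ _] := FP _ FX; apply: D; [left | right; exists s].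
    + by apply: (lift Y) => //; have [D _ _] := FP _ FY; apply: D; [right; exists r | left].
    + by right; exists (r + s); rewrite mulrDr.
  - move=> r x [[X FX Xx]|[s ->]]; last by right; exists (r * s); rewrite mulrCA.
    have [_ M _] := FP _ FX; have [|Xrx|] := M r x; first by left.
      by left; exists X.
    by right.
  - case=> [[X FX X1]|[r /esym]]; last exact: aNunit.
    by have [_ _] := FP _ FX; apply; left.
have Aa r : gen A (a * r) by right; exists r.
have A0 : gen A 0 by rewrite -(mulr0 a).
exists (gen A); split=> //; first by rewrite -[a]mulr1.
move=> z nAz; apply: contrapT => noinv.
pose B t := exists2 x, gen A x & exists r, t = x + z * r.
have Bgen t : gen B t -> B t.
  by case=> [//|[r ->]]; exists (a * r) => //; exists 0; rewrite mulr0 addr0.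
apply: (Amax B).
  split=> [t At|sub]; first by exists t; [left | exists 0; rewrite mulr0 addr0].
  apply: nAz; left; apply: sub; exists 0 => //; exists 1; ring.
split.
- move=> _ _ /Bgen[x Ax [r ->]] /Bgen[y Ay [s ->]]; left.
  by exists (x + y); [apply: AD | exists (r + s); ring].
- move=> r _ /Bgen[x Ax [s ->]]; left.
  by exists (r * x); [apply: AM | exists (r * s); ring].
- by move=> /Bgen[x Ax [r xr1]]; apply: noinv; exists x => //; exists r.
Qed.

(** The quotient by a maximal ideal containing the non-unit [a]. For a prime number [a] the residue
    field has that characteristic. *)
Lemma residue_field (R : comNzRingType) (a : R) :
  (forall r, a * r <> 1) ->
  exists (k : fieldType) (f : {rmorphism R -> k}), f a = 0.
Proof.
move=> /maximal_ideal_exists[I [Ia ID IM I1 Imax]].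
have IdealI : idealr_closed (fun x : R => `[< I x >]).
  split=> [||r x y]; first by rewrite unfold_in; apply/asboolP; rewrite -(mul0r a); apply: IM.
    by rewrite unfold_in; apply/asboolPn.
  by rewrite !unfold_in => /asboolP Ix /asboolP Iy; apply/asboolP/ID => //; apply: IM.
pose S : idealr R := HB.pack (fun x : R => `[< I x >]) (isIdealr.Build R _ IdealI).
pose k : comNzRingType := {ideal_quot S}.
have pi0 x : (\pi_k x == 0 :> k) = `[< I x >].
  by rewrite -[0 :> k](rmorph0 (\pi_k)) -Quotient.idealrBE subr0.
have kinv (x : k) : exists y, x != 0 -> y * x = 1.
  have [x0|x0] := eqVneq x 0; first by exists 0 => /eqP.
  elim/quotW: x x0 => x; rewrite pi0 => /asboolPn/Imax[y Iy [r yxr]].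
  exists (\pi_k r) => _; rewrite -rmorphM -[1 :> k](rmorph1 \pi_k).
  apply/eqP; rewrite -Quotient.idealrBE unfold_in; apply/asboolP.
  by rewrite -yxr (_ : _ - _ = -1 * y); [apply: IM | ring].
have [inv invP] := choice kinv.
pose inv' x := if x == 0 then 0 else inv x.
have invV x : x != 0 -> inv' x * x = 1 by move=> x0; rewrite /inv' (negPf x0) invP.
have inv'0 : inv' 0 = 0 by rewrite /inv' eqxx.
pose kF : fieldType := HB.pack k (GRing.ComNzRing_isField.Build k invV inv'0).
by exists kF, (\pi_k : {rmorphism R -> k}); apply/eqP; rewrite pi0; apply/asboolP.
Qed.

End ResidueField.

(** Each [th s] packs the conjugates of all entries of [x] into one polynomial, so that a single
    group element serves every entry. [F] is invariant under the group, hence has integer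
    coefficients; so the Frobenius of [k] maps roots of its image to roots, and carries the image of
    [th 1] to that of some [th s]. *)
Lemma frobenius_lift (R : comNzRingType) (k : fieldType) (f : {rmorphism R -> k})
    (p : nat) (gT : finGroupType) (act : gT -> {rmorphism R -> R}) (x : seq R) :
    p \in [pchar k] -> act 1%g =1 id ->
    (forall s t r, act (s * t)%g r = act t (act s r)) ->
    (forall r, (forall s, act s r = r) -> exists z : int, r = z%:~R) ->
  exists s, {in x, forall y, f (act s y) = f y ^+ p}.
Proof.
move=> charp act1 actM fixed.
pose th s := \poly_(i < size x) act s x`_i.
pose F : {poly {poly R}} := \prod_s ('X - (th s)%:P).
have F_int j l : exists z : int, F`_j`_l = z%:~R.
  apply: fixed => t; suff FE : map_poly (map_poly (act t)) F = F.
    by rewrite -[in RHS]FE !coef_map.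
  rewrite rmorph_prod [RHS](reindex_inj (mulIg t)) /=.
  apply: eq_bigr => s _; rewrite rmorphB /= map_polyX map_polyC /=.
  suff -> : map_poly (act t) (th s) = th (s * t)%g by [].
  apply/polyP=> i; rewrite coef_map !coef_poly.
  by case: ifP => _; [rewrite actM | exact: rmorph0].
pose frob : {rmorphism k -> k} := pFrobenius_aut charp.
pose Fk : {poly {poly k}} := map_poly (map_poly f) F.
have FkE : Fk = \prod_s ('X - (map_poly f (th s))%:P).
  rewrite /Fk rmorph_prod; apply: eq_bigr => s _.
  by rewrite rmorphB /= map_polyX map_polyC.
have frobFk : map_poly (map_poly frob) Fk = Fk.
  apply/polyP=> j; apply/polyP=> l; rewrite coef_map coef_map /=.
  rewrite !coef_map; have [z ->] := F_int j l.
  have fz : f z%:~R = z%:~R by exact: rmorph_int.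
  by apply: etrans (congr1 _ fz) (etrans (rmorph_int frob z) (esym fz)).
have : root Fk (map_poly frob (map_poly f (th 1%g))).
  rewrite -frobFk; apply: rmorph_root; rewrite FkE /root horner_prod.
  by apply/prodf_eq0; exists 1%g; rewrite // hornerXsubC subrr.
rewrite FkE /root horner_prod => /prodf_eq0[s _]; rewrite hornerXsubC subr_eq0 => /eqP eq_s.
exists s => _ /(nthP 0)[i ltix <-]; have := congr1 (fun q : {poly k} => q`_i) eq_s.
by rewrite !coef_map !coef_poly ltix act1 => <-; rewrite /frob /= pFrobenius_autE.
Qed.

Lemma map_poly_intr (A B : nzRingType) (f : {rmorphism A -> B}) (P : {poly int}) :
  map_poly f (map_poly intr P) = map_poly intr P.
Proof. by apply/polyP=> i; rewrite !coef_map_id0 ?rmorph0 ?rmorph_int. Qed.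

Lemma integral_rat_int (L : fieldExtType rat) (q : rat) :
  integralOver (intr : int -> L) q%:A -> exists z : int, q = z%:~R.
Proof.
case=> P monP rootP.
have rP : root (map_poly intr P) q.
  by rewrite -(fmorph_root (in_alg L)) map_poly_intr.
have qZ : (ratr q : algC) \in Num.int.
  apply: Cint_rat_Aint; first exact: Crat_rat.
  apply: (@root_monic_Aint (map_poly intr P)); last 2 first.
  - exact: monic_map.
  - by apply/polyOverP=> i; rewrite coef_map /= intr_int.
  by rewrite -(map_poly_intr (ratr : rat -> algC)) fmorph_root.
have [z zE] := intrP qZ; exists z; apply: (fmorph_inj (ratr : rat -> algC)).
by rewrite /= zE rmorph_int.
Qed.

Lemma intr_inj_ext (L : fieldExtType rat) : injective (intr : int -> L).
Proof.
move=> m n mn; apply: (@intr_inj rat); apply: (fmorph_inj (in_alg L)).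
by rewrite !rmorph_int.
Qed.

Section IntegralElements.
Variable L : fieldExtType rat.

Definition integral_elt : {pred L} := fun x => `[< integralOver (intr : int -> L) x >].

Lemma integral_eltP x : reflect (integralOver (intr : int -> L) x) (x \in integral_elt).
Proof. exact: asboolP. Qed.

Fact integral_elt_subring : subring_closed integral_elt.
Proof.
split=> [|x y|x y]; first exact/integral_eltP/integral1.
  by move=> /integral_eltP ix /integral_eltP iy; apply/integral_eltP/integral_sub.
by move=> /integral_eltP ix /integral_eltP iy; apply/integral_eltP/integral_mul.
Qed.
HB.instance Definition _ := GRing.isSubringClosed.Build L integral_elt integral_elt_subring.

(** The ring of integers of [L], as a type of its own: reduction modulo a prime is defined there and
    not on [L]. *)
Record integral_ring := IntegralRing
  { integral_val :> L; integral_valP : integral_val \in integral_elt }.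
HB.instance Definition _ := [isSub for integral_val].
HB.instance Definition _ := [Choice of integral_ring by <:].
HB.instance Definition _ := [SubChoice_isSubComNzRing of integral_ring by <:].

End IntegralElements.

Section IntegralGalois.
Variable L : splittingFieldType rat.
Local Notation R := (integral_ring L).

Lemma gal_integral (s : gal_of {:L}) (x : R) : s (val x) \in @integral_elt L.
Proof.
have [P monP rootP] := integral_eltP _ (integral_valP x).
apply/integral_eltP; exists P => //.
by rewrite -(map_poly_intr s) fmorph_root.
Qed.

Definition gal_act (s : gal_of {:L}) (x : R) : R := IntegralRing (gal_integral s x).

Fact gal_act_zmod s : zmod_morphism (gal_act s).
Proof. by move=> x y; apply: val_inj; rewrite /= !rmorphB. Qed.
Fact gal_act_monoid s : monoid_morphism (gal_act s).
Proof. by split=> [|x y]; apply: val_inj; rewrite /= (rmorph1, rmorphM). Qed.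
HB.instance Definition _ s := GRing.isZmodMorphism.Build R R (gal_act s) (gal_act_zmod s).
HB.instance Definition _ s := GRing.isMonoidMorphism.Build R R (gal_act s) (gal_act_monoid s).

Lemma gal_fixed_rat (x : L) : (forall s : gal_of {:L}, s x = x) -> exists q : rat, x = q%:A.
Proof.
move=> fix_x; apply/vlineP.
have galL : galois 1 {:L}.
  rewrite /galois sub1v normalFieldf andbT; apply/separableP=> y _.
  by apply: pcharf0_separable => p; rewrite pchar_lalg pchar_num.
rewrite -(galois_fixedField galL); apply/fixedFieldP; first exact: memvf.
by move=> s _; apply: fix_x.
Qed.

(** [pi] is reduction modulo a maximal ideal above [p], given a dummy value off the integral
    elements, and [s] is a Frobenius element for that ideal. *)
Lemma frobenius_of_poly (g : {poly int}) (rs : seq L) (p : nat) :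
  prime p -> map_poly intr g = \prod_(x <- rs) ('X - x%:P) ->
  exists (k : fieldType) (pi : L -> k) (s : gal_of {:L}),
    [/\ p \in [pchar k], map_poly intr g = \prod_(x <- rs) ('X - (pi x)%:P)
      & {in rs, forall x, pi (s x) = pi x ^+ p}].
Proof.
move=> p_pr gE; pose v : {rmorphism R -> L} := val.
have mong : g \is monic.
  have injL := @intr_inj_ext L.
  have := monic_prod_XsubC rs xpredT id; rewrite -gE !monicE lead_coef_map_inj //.
  by rewrite -[1](rmorph1 (intr : int -> L)) (inj_eq injL).
have int_rs x : x \in rs -> x \in @integral_elt L.
  move=> xrs; apply/integral_eltP; exists g => //.
  by rewrite gE root_prod_XsubC.
(* Otherwise [1 / p] would be an algebraic integer, hence an integer. *)
have pNunit (r : R) : p%:R * r <> 1.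
  move=> /(congr1 v); rewrite rmorphM rmorph1 rmorph_nat => pr1.
  have p0 : p%:R != 0 :> rat by rewrite pnatr_eq0 -lt0n prime_gt0.
  have vE : v r = (p%:R^-1 : rat)%:A.
    apply: (@mulfI _ p%:R); last first.
      rewrite pr1 -[p%:R](rmorph_nat (in_alg L)) -rmorphM /= divff //.
      by rewrite scale1r.
    by rewrite -[p%:R](rmorph_nat (in_alg L)) fmorph_eq0.
  have [z zE] : exists z : int, (p%:R^-1 : rat) = z%:~R.
    by apply: (@integral_rat_int L); rewrite -vE; apply/integral_eltP/integral_valP.
  have /eqP : (p%:Z * z)%:~R = 1 :> rat by rewrite intrM -zE divff.
  rewrite -[1 :> rat](rmorph1 (intr : int -> rat)) eqr_int => /eqP/(congr1 absz).
  rewrite abszM /= => /eqP; rewrite muln_eq1 => /andP[/eqP p1 _].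
  by rewrite p1 in p_pr.
have [k [f fp]] := residue_field pNunit.
have charp : p \in [pchar k] by apply/andP; split=> //; rewrite -fp rmorph_nat.
pose q x : R := insubd 0 x.
have qK x : x \in rs -> val (q x) = x by move=> /int_rs xi; rewrite insubdK.
have [s sP] : exists s, {in map q rs, forall y, f (gal_act s y) = f y ^+ p}.
  apply: frobenius_lift => //.
  - by move=> x; apply: val_inj; rewrite /= gal_id.
  - by move=> s t r; apply: val_inj; rewrite /= galM ?memvf.
  - move=> r rfix; have [a aE] : exists a : rat, val r = a%:A.
      by apply: gal_fixed_rat => s; rewrite -[in RHS](rfix s).
    have [z zE] : exists z : int, a = z%:~R.
      by apply: (@integral_rat_int L); rewrite -aE; apply/integral_eltP/integral_valP.
    exists z; apply: val_inj; rewrite aE zE.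
    exact: etrans (rmorph_int (in_alg L) z) (esym (rmorph_int v z)).
exists k, (f \o q), s; split=> //.
  have gR : map_poly intr g = \prod_(x <- rs) ('X - (q x)%:P) :> {poly R}.
    apply: (map_inj_poly val_inj); first exact: rmorph0.
    rewrite (map_poly_intr v) gE -[RHS]/(map_poly v _) map_prod_XsubC.
    by rewrite big_seq [RHS]big_seq; apply: eq_bigr => x xrs; rewrite /= qK.
  have := congr1 (map_poly f) gR; rewrite map_poly_intr => ->.
  by rewrite map_prod_XsubC.
move=> x xrs /=; rewrite -sP ?map_f //; congr (f _); apply: val_inj.
have sx : s x \in @integral_elt L by rewrite -[x]qK // gal_integral.
by rewrite /= insubdK // qK.
Qed.
End IntegralGalois.

(** * Number fields and radical numbers *)

Lemma preimage_seq (A B : eqType) (f : A -> B) (r : seq B) :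
  {in r, forall y, exists x, f x = y} -> exists s, map f s = r.
Proof.
elim: r => [|y r IH] r_in; first by exists [::].
have [|s <-] := IH; first by move=> z zr; apply: r_in; rewrite in_cons zr orbT.
by have [|x <-] := r_in y; rewrite ?mem_head //; exists (x :: s).
Qed.

Lemma exists_notin (A : eqType) (s t : seq A) : uniq t -> (size s < size t)%N ->
  exists2 x, x \in t & x \notin s.
Proof.
move=> Ut lt_st; apply/hasP; rewrite has_predC; apply: contraL lt_st => /allP sub.
by rewrite -leqNgt uniq_leq_size.
Qed.

Section NumberFieldIn.
Variable C : numClosedFieldType.
Local Notation algebraic := (algebraicOver (ratr : rat -> C)).
Local Notation rpoly := (map_poly (ratr : rat -> C)).

(** The expression of [z] as an integer combination of [r] is recorded because it places [z] in
    every field generated by [r]. *)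
Lemma primitive_element (r : seq C) : {in r, forall x, algebraic x} ->
  exists z (a : nat -> nat),
    z = \sum_(i < size r) r`_i *+ a i /\ {in r, forall x, exists p, x = (rpoly p).[z]}.
Proof.
elim: r => [_|x r IH alg_r]; first by exists 0, (fun=> 0%N); rewrite big_ord0.
have /IH[z [a [zE zP]]] : {in r, forall y, algebraic y}.
  by move=> y yr; apply: alg_r; rewrite in_cons yr orbT.
have [p p0 px] : algebraic x by apply: alg_r; rewrite mem_head.
have [q q0 qz] : algebraic (- z).
  apply: algebraic_opp; rewrite zE; elim/big_ind: _ => [||i _].
  - exact: algebraic0.
  - by move=> u v; apply: algebraic_add.
  have ri : algebraic r`_i by apply: alg_r; rewrite in_cons mem_nth ?orbT.
  rewrite -mulr_natr; apply: algebraic_mul => //.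
  by rewrite -[_%:R](rmorph_nat (ratr : rat -> C)); apply: algebraic_id.
(* [pchar0_PET] returns a primitive element [x *+ n - y]; with [y = - z] the coefficients stay
   natural numbers. *)
have [n [[qz' zE'] [px' xE']]] := pchar0_PET q0 qz p0 px (pchar_num rat).
rewrite opprK in zE' xE'; exists (x *+ n + z), (fun i => if i is j.+1 then a j else n).
split; first by rewrite big_ord_recl /= zE.
move=> y; rewrite in_cons => /predU1P[->|/zP[s ->]]; first by exists px'.
by exists (s \Po (- qz')); rewrite map_comp_poly horner_comp rmorphN hornerN zE' opprK.
Qed.

Lemma irreducible_annihilator (z : C) : algebraic z ->
  exists p, [/\ p != 0, root (rpoly p) z & irreducible_poly p].
Proof.
case=> p; have [n] := ubnP (size p); elim: n p => // n IH p lep p0 pz.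
have [[q [q0 qz ltqp]]|minp] := pselect (exists q : {poly rat},
    [/\ q != 0, root (rpoly q) z & (size q < size p)%N]).
  by apply: (IH q) => //; apply: leq_trans ltqp _.
exists p; split=> //; apply/(subfx_irreducibleP pz p0) => q qz q0.
by rewrite leqNgt; apply/negP => ltqp; apply: minp; exists q.
Qed.

(** The roots in [C] of a rational [P] vanishing on [s] are polynomials in one primitive element
    [z]. The field of [z], built abstractly from an irreducible annihilator, is a splitting field of
    [P] that embeds in [C]. *)
Lemma splitting_field_in (s : seq C) : {in s, forall x, algebraic x} ->
  exists (L : splittingFieldType rat) (i : {rmorphism L -> C}),
    {in s, forall x, exists y, i y = x}.
Proof.
move=> alg_s.
have [P [P0 Ps]] : exists P : {poly rat}, P != 0 /\ {in s, forall x, root (rpoly P) x}.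
  elim: s alg_s => [|x s IH] alg_s; first by exists 1; rewrite oner_eq0.
  have [|P [P0 Ps]] := IH; first by move=> y ys; apply: alg_s; rewrite in_cons ys orbT.
  have [p p0 px] : algebraic x by apply: alg_s; rewrite mem_head.
  exists (p * P); split=> [|y]; first by rewrite mulf_neq0.
  by rewrite rmorphM rootM in_cons => /predU1P[->|/Ps->]; rewrite ?px ?orbT.
have [r Pr] := closed_field_poly_normal (rpoly P).
have rP : r =i root (rpoly P).
  move=> x; rewrite -root_prod_XsubC -[RHS]/(root (rpoly P) x) Pr rootZ //.
  by rewrite lead_coef_eq0 map_poly_eq0.
have [|z [a [zE zr]]] := @primitive_element r.
  by move=> x; rewrite rP => Px; exists P.
have [|p [p0 pz irr_p]] := @irreducible_annihilator z.
  rewrite zE; elim/big_ind: _ => [||i _].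
  - exact: algebraic0.
  - by move=> u v; apply: algebraic_add.
  rewrite -mulr_natr; apply: algebraic_mul.
    by exists P => //; rewrite -[root _ _]/(_ \in root _) -rP mem_nth.
  by rewrite -[_%:R](rmorph_nat (ratr : rat -> C)); apply: algebraic_id.
pose L0 := SubFieldExtType pz irr_p.
pose i0 : {rmorphism L0 -> C} := @subfx_inj _ _ (ratr : {rmorphism rat -> C}) z p.
have [w wE] : exists w : L0, i0 w = z by exists (subfx_root _ z p); apply: subfx_inj_root.
have gen_w (x : L0) : exists q : {poly rat}, x = (map_poly (in_alg L0) q).[w].
  have [q xE] := subfxEroot pz p0 x; exists q; rewrite {}xE; congr (_.[_]).
  by apply: (fmorph_inj i0); rewrite wE; apply: subfx_inj_root.
have i0q (q : {poly rat}) : i0 (map_poly (in_alg L0) q).[w] = (rpoly q).[z].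
  rewrite -horner_map wE -map_poly_comp; congr (_.[_]); apply: eq_map_poly => c /=.
  exact: subfx_inj_base.
have r_in x : x \in r -> exists y, i0 y = x.
  by move=> /zr[q ->]; exists (map_poly (in_alg L0) q).[w].
have [r0 r0E] := preimage_seq r_in.
have splitL0 : SplittingField.axiom L0.
  exists (map_poly (in_alg L0) P); first exact: alg_polyOver.
  exists r0.
    rewrite -(eqp_map i0) -map_poly_comp map_prod_XsubC.
    rewrite -(big_map i0 xpredT (fun y => 'X - y%:P)) r0E.
    rewrite (@eq_map_poly _ _ _ (ratr : rat -> C)); last by move=> c; apply: subfx_inj_base.
    by rewrite Pr eqp_scale // lead_coef_eq0 map_poly_eq0.
  apply/vspaceP=> x; rewrite memvf; have [q ->] := gen_w x.
  have w_in : w \in <<1 & r0>>%VS.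
    have -> : w = \sum_(i < size r0) r0`_i *+ a i.
      apply: (fmorph_inj i0); rewrite wE zE rmorph_sum -r0E size_map.
      by apply: eq_bigr => i _; rewrite rmorphMn (nth_map 0).
    by apply: memv_suml => i _; rewrite rpredMn // seqv_sub_adjoin ?mem_nth.
  by apply: rpred_horner; rewrite ?alg_polyOver.
pose L : splittingFieldType rat := HB.pack L0 (FieldExt_isSplittingField.Build rat L0 splitL0).
by exists L, i0 => x /Ps; rewrite -[root _ _]/(_ \in root _) -rP; apply: r_in.
Qed.

End NumberFieldIn.

(** * Roots and the derived series of a Galois group *)

Section DerivedSeries.
Variable L : splittingFieldType rat.
Local Notation G := [set: gal_of {:L}].
Implicit Types (u z : L) (g h : gal_of {:L}).

Lemma galEM g h u : (g * h)%g u = h (g u).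
Proof. by rewrite galM ?memvf. Qed.

Fact gal_fixer_group_set u : group_set [set g : gal_of {:L} | g u == u].
Proof.
apply/group_setP; split=> [|g h]; first by rewrite inE gal_id.
by rewrite !inE galEM => /eqP-> /eqP->.
Qed.

(** The automorphisms fixing [u] form a group, so it suffices to treat commutators; [[~ a, b]] fixes
    [u] once the inverses of [a] and [b] commute in their action on [u]. *)
Lemma commutators_fix u k :
  {in (G^`(k))%g &, forall g h, h (g u) = g (h u)} ->
  {in (G^`(k.+1))%g, forall g, g u = u}.
Proof.
move=> comm_u g; rewrite dergSn => gG; apply/eqP.
suff /subsetP/(_ g gG) : ([~: G^`(k), G^`(k)] \subset Group (gal_fixer_group_set u))%g.
  by rewrite inE.
rewrite gen_subG; apply/subsetP=> _ /imset2P[a b aG bG ->].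
have -> : [~ a, b]%g = (a^-1 * b^-1 * (b^-1 * a^-1)^-1)%g.
  by rewrite commgEl conjgE invMg !invgK !mulgA.
rewrite inE galEM (galEM a^-1%g b^-1%g) comm_u ?groupV //.
by rewrite -(galEM b^-1%g a^-1%g) -galEM mulgV gal_id.
Qed.

Lemma der_fix_leq u j k : (j <= k)%N ->
  {in (G^`(j))%g, forall g, g u = u} -> {in (G^`(k))%g, forall g, g u = u}.
Proof.
move=> /subnKC <- fix_u; elim: (k - j)%N => [|n IH] g; rewrite ?addn0 ?addnS.
  exact: fix_u.
by move=> /(subsetP (der_subS _ _))/IH.
Qed.

(** Automorphisms act on a root of unity by raising it to powers, and such actions commute. *)
Lemma unity_root_fixed n z : (0 < n)%N -> z ^+ n = 1 -> {in (G^`(1))%g, forall g, g z = z}.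
Proof.
move=> n0 zn; apply: commutators_fix => g h _ _.
have [m zm _] := prim_order_exists n0 zn.
have pow f : exists i, (f : gal_of {:L}) z = z ^+ i.
  have /(prim_rootP zm)[i ->] : f z ^+ m = 1 by rewrite -rmorphXn (prim_expr_order zm) rmorph1.
  by exists i.
have [[i gi] [j hj]] := (pow g, pow h).
by rewrite gi hj !rmorphXn /= gi hj -!exprM mulnC.
Qed.

(** Elements of the derived subgroup [k.+1] multiply [u] by roots of unity, which that subgroup
    fixes; so their actions on [u] commute, and one more derived step fixes [u]. *)
Lemma root_fixed u n k : (0 < n)%N ->
  {in (G^`(k))%g, forall g, g (u ^+ n) = u ^+ n} -> {in (G^`(k.+2))%g, forall g, g u = u}.
Proof.
move=> n0 fix_un; apply: commutators_fix => g h gG hG.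
have [->|u0] := eqVneq u 0; first by rewrite !rmorph0.
have gG1 f : f \in (G^`(k.+1))%g -> exists2 z, f u = z * u & {in (G^`(k.+1))%g, forall g, g z = z}.
  move=> fG; exists (f u / u); first by rewrite divfK.
  have : (f u / u) ^+ n = 1.
    rewrite expr_div_n -rmorphXn /= fix_un ?divff ?expf_neq0 //.
    exact: (subsetP (der_subS _ _)).
  by move=> /(unity_root_fixed n0)/(der_fix_leq _); apply.
have [y gu fix_y] := gG1 g gG; have [z hu fix_z] := gG1 h hG.
by rewrite gu hu !rmorphM /= fix_y // fix_z // gu hu mulrCA.
Qed.

End DerivedSeries.

(** * Radical numbers *)

Section Radical.
Variable C : numClosedFieldType.
Local Notation algebraic := (algebraicOver (ratr : rat -> C)).

Inductive radical : C -> Prop :=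
  | radical_int (n : int) : radical n%:~R
  | radicalB x y : radical x -> radical y -> radical (x - y)
  | radicalM x y : radical x -> radical y -> radical (x * y)
  | radicalV x : radical x -> radical x^-1
  | radical_root k y : (0 < k)%N -> radical (y ^+ k) -> radical y.

Lemma radical_algebraic x : radical x -> algebraic x.
Proof.
elim=> {x} [n|x y _ ax _ ay|x y _ ax _ ay|x _ ax|k y k0 _ [p p0 pyk]].
- by rewrite -(rmorph_int (ratr : rat -> C)); apply: algebraic_id.
- exact: algebraic_sub.
- exact: algebraic_mul.
- exact: algebraic_inv.
exists (p \Po 'X^k); last first.
  by rewrite map_comp_poly map_polyXn /root horner_comp hornerXn.
by rewrite comp_poly_eq0 // size_polyXn ltnS.
Qed.

(** Asking this of every splitting field that contains [s] lets two such numbers be treated in one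
    field, since enlarging [s] preserves the property. *)
Definition derived_fixed (s : seq C) (x : C) :=
  forall (L : splittingFieldType rat) (i : {rmorphism L -> C}),
    {in s, forall y, exists u, i u = y} ->
  exists2 u, i u = x & exists k, {in ([set: gal_of {:L}]^`(k))%g, forall g : gal_of {:L}, g u = u}.

Lemma radical_derived_fixed x : radical x ->
  exists2 s : seq C, {in s, forall y, algebraic y} & derived_fixed s x.
Proof.
have merge (s t : seq C) : {in s, forall y, algebraic y} -> {in t, forall y, algebraic y} ->
    {in s ++ t, forall y, algebraic y}.
  by move=> hs ht y; rewrite mem_cat => /orP[/hs|/ht].
(* The operation is uniform in the field, to be transported along the embedding into [C] and along
   automorphisms. *)
have op2 (f : forall K : fieldType, K -> K -> K) x1 x2 s1 s2 :
    (forall (K L : fieldType) (i : {rmorphism K -> L}) u v, i (f K u v) = f L (i u) (i v)) ->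
    derived_fixed s1 x1 -> derived_fixed s2 x2 -> derived_fixed (s1 ++ s2) (f C x1 x2).
  move=> fM d1 d2 L i sL.
  have [|u1 iu1 [k1 fix1]] := d1 L i; first by move=> y ys; apply: sL; rewrite mem_cat ys.
  have [|u2 iu2 [k2 fix2]] := d2 L i; first by move=> y ys; apply: sL; rewrite mem_cat ys orbT.
  exists (f L u1 u2); first by rewrite fM iu1 iu2.
  exists (maxn k1 k2) => g gG.
  rewrite (fM _ _ g) /= (der_fix_leq (leq_maxl _ _) fix1 gG).
  by rewrite (der_fix_leq (leq_maxr _ _) fix2 gG).
elim=> {x} [n|x y _ [s as_ ds] _ [t at_ dt]|x y _ [s as_ ds] _ [t at_ dt]|
    x _ [s as_ ds]|k y k0 yk [s as_ ds]].
- exists [::] => // L i _; exists n%:~R; first by rewrite rmorph_int.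
  by exists 0%N => g _; rewrite rmorph_int.
- exists (s ++ t); first exact: merge.
  by apply: (op2 (fun K a b => a - b) _ _ _ _ _ ds dt) => K L i u v; rewrite rmorphB.
- exists (s ++ t); first exact: merge.
  by apply: (op2 (fun K a b => a * b) _ _ _ _ _ ds dt) => K L i u v; rewrite rmorphM.
- exists (s ++ s); first exact: merge.
  by apply: (op2 (fun K a b => a^-1) _ _ _ _ _ ds ds) => K L i u v; rewrite fmorphV.
exists (y :: s) => [z|L i sL].
  by rewrite in_cons => /predU1P[->|/as_]; [apply/radical_algebraic/(radical_root k0) |].
have [|v iv [j fix_v]] := ds L i; first by move=> z zs; apply: sL; rewrite in_cons zs orbT.
have [u iu] := sL y (mem_head _ _); exists u => //; exists j.+2.
apply: (root_fixed k0); suff -> : u ^+ k = v by [].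
by apply: (fmorph_inj i); rewrite rmorphXn iu iv.
Qed.

Lemma radical_morph (f : {rmorphism C -> C}) x : radical x -> radical (f x).
Proof.
elim=> {x} [n|x y _ fx _ fy|x y _ fx _ fy|x _ fx|k y k0 _ fyk].
- by rewrite rmorph_int; apply: radical_int.
- by rewrite rmorphB; apply: radicalB.
- by rewrite rmorphM; apply: radicalM.
- by rewrite fmorphV; apply: radicalV.
by apply: (radical_root k0); rewrite -rmorphXn.
Qed.

Lemma radical0 : radical 0. Proof. exact: (radical_int 0). Qed.
Lemma radicalD x y : radical x -> radical y -> radical (x + y).
Proof.
by move=> rx ry; rewrite -[y]opprK -[- y]sub0r; do 2![apply: radicalB => //]; apply: radical0.
Qed.

End Radical.

(** * Symmetric Galois groups *)

Section SymmetricGalois.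
Variables (L : splittingFieldType rat) (rs : seq L).
Implicit Types (g h : gal_of {:L}) (a b c : L).

Definition gal_transposes h a b :=
  [/\ h a = b, h b = a & {in rs, forall c, c != a -> c != b -> h c = c}].

Definition all_transpositions :=
  {in rs &, forall a b, a != b -> exists h, gal_transposes h a b}.

Lemma galVK h a : (h^-1)%g (h a) = a.
Proof. by rewrite -galEM mulgV gal_id. Qed.

Lemma galKV h a : h ((h^-1)%g a) = a.
Proof. by rewrite -galEM mulVg gal_id. Qed.

(** Conjugating one transposition gives all others. The product [f = u * m * v], acting from left to
    right, carries [(a, b)] to [(a0, b0)]: [u] moves [a] to [r], [m] adjusts the second root inside
    the stabilizer of [r], and [v] moves [r] to [a0]. *)
Lemma all_transpositions_of_doubly_transitive r :
  (forall h, {in rs, forall a, h a \in rs}) -> r \in rs ->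
  {in rs &, forall a b, exists h, h a = b} ->
  {in rs &, forall a b, a != r -> b != r -> exists h, h r = r /\ h a = b} ->
  (exists h a b, [/\ a \in rs, b \in rs, a != b & gal_transposes h a b]) ->
  all_transpositions.
Proof.
move=> rs_stable rrs trans1 trans2 [t [a0 [b0 [a0rs b0rs ab0 [ta0 tb0 tfix]]]]] a b ars brs ab.
have [u ua] := trans1 _ _ ars rrs; have [v vr] := trans1 _ _ rrs a0rs.
pose w : gal_of {:L} := (v^-1)%g.
have wa0 : w a0 = r by rewrite -vr galVK.
have [||||m [mr mb]] := trans2 (u b) (w b0); rewrite ?rs_stable //.
- by rewrite -ua (inj_eq (fmorph_inj u)) eq_sym.
- by rewrite -wa0 (inj_eq (fmorph_inj w)) eq_sym.
have [f [fa fb]] : exists f : gal_of {:L}, f a = a0 /\ f b = b0.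
  by exists (u * m * v)%g; rewrite !galEM ua mr vr mb galKV.
exists (f * t * f^-1)%g; split=> [||c crs ca cb]; rewrite !galEM.
- by rewrite fa ta0 -fb galVK.
- by rewrite fb tb0 -fa galVK.
rewrite tfix ?galVK ?rs_stable //.
- by rewrite -fa (inj_eq (fmorph_inj f)).
- by rewrite -fb (inj_eq (fmorph_inj f)).
Qed.

Definition gal_3cycle h a b c :=
  [/\ h a = b, h b = c, h c = a & {in rs, forall d, d \notin [:: a; b; c] -> h d = d}].

(* For distinct [a, b, c, d, e] the 3-cycle [(a b c)] is the commutator of
   [(a c d)] and [(a b e)], so 3-cycles survive in every derived subgroup. *)
Lemma derived_3cycles k : all_transpositions -> uniq rs -> (4 < size rs)%N ->
  {in rs & &, forall a b c, uniq [:: a; b; c] ->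
    exists2 h, h \in ([set: gal_of {:L}]^`(k))%g & gal_3cycle h a b c}.
Proof.
move=> transp Urs sz_rs; elim: k => [|k IH] a b c ars brs crs /=; rewrite !inE negb_or.
  case/and3P=> /andP[ab ac] bc _.
  have [s [sa sb s_fix]] := transp a b ars brs ab.
  have [t [ta tc t_fix]] := transp a c ars crs ac.
  (* [(a b)] followed by [(a c)] is the 3-cycle [(a b c)]. *)
  exists (s * t)%g; first by rewrite derg0 inE.
  split; rewrite ?galEM.
  - by rewrite sa t_fix // eq_sym.
  - by rewrite sb ta.
  - by rewrite s_fix ?tc // eq_sym.
  move=> d drs; rewrite !inE !negb_or => /and3P[da db dc].
  by rewrite galEM s_fix // t_fix.
case/and3P=> /andP[ab ac] bc _.
have more t := @exists_notin _ t rs Urs.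
have [d drs] := more [:: a; b; c] (ltnW sz_rs); rewrite !inE !negb_or => /and3P[da db dc].
have [e ers] := more [:: a; b; c; d] sz_rs.
rewrite !inE !negb_or => /and4P[ea eb ec ed].
have [|s sG [sa sc sd s_fix]] := IH a c d ars crs drs.
  by rewrite /= !inE negb_or ac (eq_sym a) da (eq_sym c) dc.
have [|t tG [ta tb te t_fix]] := IH a b e ars brs ers.
  by rewrite /= !inE negb_or ab (eq_sym a) ea (eq_sym b) eb.
have inv h x y : h x = y -> (h^-1)%g y = x by move=> <-; rewrite galVK.
exists [~ s, t]%g; first by rewrite dergSn mem_commg.
have E x : [~ s, t]%g x = t (s ((t^-1)%g ((s^-1)%g x))).
  by rewrite commgEl conjgE !galEM.
have sb : s b = b by rewrite s_fix // !inE !negb_or (eq_sym b a) ab bc (eq_sym b) db.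
have se : s e = e by rewrite s_fix // !inE !negb_or ea ec ed.
have tc : t c = c by rewrite t_fix // !inE !negb_or !(eq_sym c) ac bc ec.
have td : t d = d by rewrite t_fix // !inE !negb_or da db (eq_sym d) ed.
split; rewrite ?E.
- by rewrite (inv _ _ _ sd) (inv _ _ _ td) sd ta.
- by rewrite (inv _ _ _ sb) (inv _ _ _ ta) sa tc.
- by rewrite (inv _ _ _ sa) (inv _ _ _ te) se te.
move=> x xrs; rewrite !inE !negb_or => /and3P[xa xb xc]; rewrite E.
have [->|xd] := eqVneq x d; first by rewrite (inv _ _ _ sc) (inv _ _ _ tc) sc td.
have [->|xe] := eqVneq x e; first by rewrite (inv _ _ _ se) (inv _ _ _ tb) sb tb.
have sx : s x = x by rewrite s_fix // !inE !negb_or xa xc.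
have tx : t x = x by rewrite t_fix // !inE !negb_or xa xb.
by rewrite (inv _ _ _ sx) (inv _ _ _ tx) sx.
Qed.

End SymmetricGalois.

(** A common splitting field [L] contains the roots of [g] and the numbers [s] attached to [x].
    There some derived subgroup fixes [x], while a 3-cycle in it moves [x]. The symmetry is assumed
    for every [L] because [L] depends on [s]. *)
Lemma root_not_radical (C : numClosedFieldType) (g : {poly int}) (x : C) :
  g \is monic -> (5 < size g)%N -> root (map_poly intr g) x ->
  (forall (L : splittingFieldType rat) (rs : seq L),
     map_poly intr g = \prod_(y <- rs) ('X - y%:P) -> uniq rs /\ all_transpositions rs) ->
  ~ radical x.
Proof.
move=> mong szg gx symg /radical_derived_fixed[s alg_s fix_s].
have [r rE] := closed_field_poly_normal (map_poly intr g : {poly C}).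
rewrite (monicP _) ?monic_map // scale1r in rE.
have xr : x \in r by rewrite -root_prod_XsubC -rE.
have [|L [i sri]] := @splitting_field_in C (r ++ s).
  move=> y; rewrite mem_cat => /orP[|/alg_s//]; rewrite -root_prod_XsubC -rE => gy.
  exists (map_poly intr g); first by rewrite monic_neq0 ?monic_map.
  by rewrite map_poly_intr.
have [|rs rsE] := @preimage_seq _ _ i r.
  by move=> y yr; apply: sri; rewrite mem_cat yr.
have gL : map_poly intr g = \prod_(y <- rs) ('X - y%:P).
  apply: (map_inj_poly (fmorph_inj i) (rmorph0 i)).
  by rewrite map_poly_intr rE -rsE map_prod_XsubC big_map.
have [Urs transp] := symg L rs gL.
have sz_rs : (4 < size rs)%N.
  rewrite -ltnS -(size_prod_XsubC rs id) -gL size_map_inj_poly //.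
  exact: intr_inj_ext.
have [|u iu [k fix_u]] := fix_s L i; first by move=> y ys; apply: sri; rewrite mem_cat ys orbT.
have urs : u \in rs by rewrite -(mem_map (fmorph_inj i)) rsE iu.
have more t := @exists_notin _ t rs Urs.
have [b brs] := more [:: u] (ltnW (ltnW (ltnW sz_rs))); rewrite !inE => bu.
have [c crs] := more [:: u; b] (ltnW (ltnW sz_rs)); rewrite !inE negb_or => /andP[cu cb].
have [|h hG [hu _ _ _]] := @derived_3cycles _ _ k transp Urs sz_rs u b c urs brs crs.
  by rewrite /= !inE negb_or !(eq_sym u) bu cu (eq_sym b) cb.
by move: bu; rewrite -hu (fix_u _ hG) eqxx.
Qed.

Lemma uniq_simple_roots (k : fieldType) (ys : seq k) :
  let q := \prod_(y <- ys) ('X - y%:P) in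
  (forall y, root q y -> q^`().[y] != 0) -> uniq ys.
Proof.
move=> /=; elim: ys => // y ys IH; rewrite big_cons /=.
set q := \prod_(z <- ys) _ in IH * => simple.
have dE z : (('X - y%:P) * q)^`().[z] = q.[z] + (z - y) * q^`().[z].
  by rewrite derivM derivXsubC mul1r hornerD hornerM hornerXsubC.
apply/andP; split.
  rewrite -root_prod_XsubC -/q; have := simple y.
  by rewrite dE subrr mul0r addr0 rootM root_XsubC eqxx => /(_ isT).
apply: IH => z qz; have := simple z; rewrite dE rootM qz orbT => /(_ isT).
by rewrite (rootP qz) add0r mulf_eq0 negb_or => /andP[].
Qed.

(** * Cycle types of Frobenius elements *)

Section FrobeniusCycles.
Variables (g : {poly int}) (p : nat).

(** Here and in the next definitions all fields of characteristic [p] are covered, because the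
    residue field comes from Zorn's lemma and is not explicit. *)
Definition simple_roots_mod := forall (k : fieldType) (y : k), p \in [pchar k] ->
  root (map_poly intr g) y -> (map_poly intr g)^`().[y] != 0.

(* The Frobenius permutes the roots of [g] modulo [p] in a single cycle. *)
Definition one_cycle_mod := forall (k : fieldType) (y : k), p \in [pchar k] ->
  root (map_poly intr g) y -> forall j, (0 < j < (size g).-1)%N -> y ^+ (p ^ j) != y.

(* The Frobenius fixes the root [r] and permutes the others in a single cycle. *)
Definition fixed_point_cycle_mod (r : int) := forall (k : fieldType) (y : k), p \in [pchar k] ->
  root (map_poly intr g) (r%:~R : k) /\
  (root (map_poly intr g) y -> y != r%:~R ->
   forall j, (0 < j < (size g).-2)%N -> y ^+ (p ^ j) != y).

(* The [m]-th power of the Frobenius is a transposition of the roots. *)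
Definition transposition_mod (m : nat) := forall k : fieldType, p \in [pchar k] ->
  exists u v : {poly k}, [/\ u != 0, (size u < size g)%N, v != 0, (size v <= 3)%N &
    forall y, root (map_poly intr g) y -> u.[y] = y ^+ (p ^ m) - y /\ (u.[y] = 0 \/ v.[y] = 0)].

Variables (L : splittingFieldType rat) (rs : seq L).
Hypothesis p_pr : prime p.
Hypothesis gE : map_poly intr g = \prod_(x <- rs) ('X - x%:P).

Lemma gal_roots_stable (h : gal_of {:L}) : {in rs, forall x, h x \in rs}.
Proof.
move=> x xrs; rewrite -root_prod_XsubC -gE -(map_poly_intr h) /=.
by rewrite fmorph_root gE root_prod_XsubC.
Qed.

Lemma size_roots : (size rs).+1 = size g.
Proof. by rewrite -(size_prod_XsubC rs id) -gE size_map_inj_poly //; apply: intr_inj_ext. Qed.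

Lemma galSX (h : gal_of {:L}) n x : (h ^+ n.+1)%g x = h ((h ^+ n)%g x).
Proof. by rewrite expgSr galEM. Qed.

Lemma simple_roots_mod_inj (k : fieldType) (pi : L -> k) :
  p \in [pchar k] -> map_poly intr g = \prod_(x <- rs) ('X - (pi x)%:P) ->
  uniq rs -> simple_roots_mod ->
  {in rs &, injective pi} /\ {in rs, forall x, root (map_poly intr g) (pi x)}.
Proof.
move=> charp gk Urs simple.
have gk' : map_poly intr g = \prod_(y <- map pi rs) ('X - y%:P) by rewrite gk big_map.
split=> [|x xrs]; last by rewrite gk' root_prod_XsubC map_f.
have Upi : uniq (map pi rs).
  by apply: uniq_simple_roots => y; rewrite -gk'; apply: simple.
move=> _ _ /(nthP 0)[i ilt <-] /(nthP 0)[j jlt <-] /eqP.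
by rewrite -!(nth_map 0 (pi 0)) // nth_uniq ?size_map // => /eqP->.
Qed.

(** A coincidence between iterates [i < j] would, after cancelling [s ^+ i], give
    [pi x ^+ (p ^ (j - i)) = pi x]. *)
Lemma frobenius_orbit (k : fieldType) (pi : L -> k) (s : gal_of {:L}) x m :
  {in rs, forall y, pi (s y) = pi y ^+ p} -> x \in rs ->
  (forall j, (0 < j < m)%N -> pi x ^+ (p ^ j) != pi x) ->
  [/\ uniq [seq (s ^+ j)%g x | j <- iota 0 m]
    & forall j, pi ((s ^+ j)%g x) = pi x ^+ (p ^ j)].
Proof.
move=> piF xrs pix.
have piX j : pi ((s ^+ j)%g x) = pi x ^+ (p ^ j).
  elim: j => [|j IH]; first by rewrite expg0 gal_id.
  by rewrite galSX piF ?gal_roots_stable // IH -exprM expnSr.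
split=> //; rewrite map_inj_in_uniq ?iota_uniq // => i j; rewrite !mem_iota !add0n /= => im jm.
wlog lt_ij : i j im jm / (i < j)%N.
  move=> W; have [lt_ij|lt_ji|//] := ltngtP i j; first exact: W.
  by move/esym/(W _ _ jm im lt_ji).
move=> eq_ij; have := pix (j - i)%N.
rewrite subn_gt0 lt_ij (leq_ltn_trans (leq_subr _ _) jm) => /(_ isT)/negP[]; apply/eqP.
rewrite -piX; congr (pi _); apply: (fmorph_inj (s ^+ i)%g).
by apply: etrans (esym (galEM _ _ _)) _; rewrite -expgD subnK // ltnW.
Qed.

(** The first [size rs] iterates of a root are distinct and lie in [rs]: they exhaust [rs], which
    therefore has no repetitions either. *)
Lemma frobenius_transitive : one_cycle_mod ->
  uniq rs /\ {in rs &, forall a b, exists h : gal_of {:L}, h a = b}.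
Proof.
move=> cyc; have [k [pi [s [charp gk piF]]]] := frobenius_of_poly p_pr gE.
have orb x : x \in rs -> [/\ uniq [seq (s ^+ j)%g x | j <- iota 0 (size rs)]
    & {subset [seq (s ^+ j)%g x | j <- iota 0 (size rs)] <= rs}].
  move=> xrs; split; last by move=> _ /mapP[j _ ->]; apply: gal_roots_stable.
  have [|//] := frobenius_orbit (m := size rs) piF xrs.
  move=> j jn; apply: (cyc k) => //; last by rewrite -size_roots.
  by rewrite gk -(big_map pi xpredT (fun y => 'X - y%:P)) root_prod_XsubC map_f.
split=> [|a b ars brs].
  case: (posnP (size rs)) => [/size0nil-> //|rs0].
  have xrs := mem_nth 0 rs0; have [U sub] := orb _ xrs.
  by apply: leq_size_uniq U sub _; rewrite size_map size_iota.
have [U sub] := orb _ ars.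
have [|_ eq_orb] := uniq_min_size U sub; first by rewrite size_map size_iota.
by move: brs; rewrite -eq_orb => /mapP[j _ ->]; exists (s ^+ j)%g.
Qed.

(** The root [x] above [r] is fixed by the Frobenius, as [r ^+ p = r] in [k]; the orbit of any other
    root has as many elements as [rem x rs]. *)
Lemma frobenius_stabilizer r : uniq rs -> fixed_point_cycle_mod r -> simple_roots_mod ->
  exists2 x, x \in rs & {in rs &, forall a b, a != x -> b != x ->
    exists h : gal_of {:L}, h x = x /\ h a = b}.
Proof.
move=> Urs cyc simple; have [k [pi [s [charp gk piF]]]] := frobenius_of_poly p_pr gE.
have [pi_inj gpi] := simple_roots_mod_inj charp gk Urs simple.
have [gr _] := cyc k 0 charp.
rewrite gk -(big_map pi xpredT (fun y => 'X - y%:P)) root_prod_XsubC in gr.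
case/mapP: gr => x xrs rE; exists x => //.
have pi_x a : a \in rs -> a != x -> pi a != r%:~R.
  by move=> ars ax; rewrite rE (inj_in_eq pi_inj).
have sx j : (s ^+ j)%g x = x.
  elim: j => [|j IH]; first by rewrite expg0 gal_id.
  rewrite galSX IH; apply: pi_inj; rewrite ?gal_roots_stable // piF // -rE.
  by rewrite -(pFrobenius_autE charp) rmorph_int.
move=> a b ars brs ax bx.
have [j|U _] := frobenius_orbit (m := (size g).-2) piF ars.
  by have [_] := cyc k (pi a) charp; apply; rewrite ?gpi ?pi_x.
set o := [seq _ | _ <- _] in U.
have sub : {subset o <= rem x rs}.
  move=> _ /mapP[j _ ->]; rewrite mem_rem_uniq // inE gal_roots_stable // andbT.
  by rewrite -[X in _ != X](sx j) (inj_eq (fmorph_inj (s ^+ j)%g)).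
have [|_ eq_orb] := uniq_min_size U sub.
  by rewrite size_rem // size_map size_iota -size_roots.
have : b \in rem x rs by rewrite mem_rem_uniq // inE bx.
by rewrite -eq_orb => /mapP[j _ ->]; exists (s ^+ j)%g.
Qed.

(** Being nonzero and smaller than [g], [u] cannot vanish at all the roots, so the power [h] of the
    Frobenius moves one of them. Moved roots reduce to roots of [v], so at most two are moved. *)
Lemma frobenius_transposition m : uniq rs -> transposition_mod m -> simple_roots_mod ->
  exists h a b, [/\ a \in rs, b \in rs, a != b & gal_transposes rs h a b].
Proof.
move=> Urs transp simple; have [k [pi [s [charp gk piF]]]] := frobenius_of_poly p_pr gE.
have [pi_inj gpi] := simple_roots_mod_inj charp gk Urs simple.
have [u [v [u0 szu v0 szv uvP]]] := transp k charp.
pose h : gal_of {:L} := (s ^+ m)%g.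
have uE x : x \in rs -> u.[pi x] = pi (h x) - pi x.
  move=> xrs; have [-> _] := uvP _ (gpi x xrs).
  (* [m := 0] makes the condition on exponents vacuous and leaves the formula for iterates. *)
  have [|_ ->] // := frobenius_orbit (m := 0) piF xrs.
  by move=> j; rewrite ltn0 andbF.
have u_fix x : x \in rs -> (u.[pi x] == 0) = (h x == x).
  by move=> xrs; rewrite uE // subr_eq0 (inj_in_eq pi_inj) ?gal_roots_stable.
have moved x : x \in rs -> h x != x -> root v (pi x).
  by move=> xrs; rewrite -u_fix // => /eqP ux; have [_ []//] := uvP _ (gpi x xrs); move/rootP.
have [a ars ha] : exists2 a, a \in rs & h a != a.
  apply/hasP; rewrite has_predC; apply: contraL szu => /allP fix_h.
  rewrite -leqNgt -size_roots -(size_map pi) max_poly_roots //; last by rewrite map_inj_in_uniq.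
  by apply/allP=> _ /mapP[x xrs ->]; rewrite /root u_fix //; apply: fix_h.
exists h, a, (h a); have hars := gal_roots_stable h ars.
have hha : h (h a) != h a by rewrite (inj_eq (fmorph_inj h)).
have two c : c \in rs -> h c != c -> c = a \/ c = h a.
  move=> crs hc; have [->|ca] := eqVneq c a; first by left.
  have [->|cha] := eqVneq c (h a); first by right.
  exfalso; move: szv; apply/negP; rewrite -ltnNge.
  apply: (@leq_ltn_trans (size (map pi [:: c; a; h a]))) => //.
  apply: max_poly_roots => //.
    by rewrite /= !moved.
  rewrite map_inj_in_uniq /= ?inE ?negb_or ?ca ?cha 1?eq_sym ?ha //.
  move=> y z; rewrite !inE => /or3P[]/eqP-> /or3P[]/eqP->; exact: pi_inj.
split=> //; first by rewrite eq_sym.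
split=> //.
  have hhha : h (h (h a)) != h (h a) by rewrite (inj_eq (fmorph_inj h)).
  have [//|eq_a] := two _ (gal_roots_stable h hars) hhha.
  by rewrite eq_a eqxx in hha.
move=> c crs ca cha; apply/eqP; apply/negPn/negP => hc; have [eq_c|eq_c] := two c crs hc.
  by rewrite eq_c eqxx in ca.
by rewrite eq_c eqxx in cha.
Qed.

End FrobeniusCycles.

Lemma symmetric_of_frobenius (g : {poly int}) (p1 p2 p3 : nat) (r : int) (m : nat)
    (L : splittingFieldType rat) (rs : seq L) :
  prime p1 -> prime p2 -> prime p3 -> one_cycle_mod g p1 ->
  fixed_point_cycle_mod g p2 r -> simple_roots_mod g p2 ->
  transposition_mod g p3 m -> simple_roots_mod g p3 ->
  map_poly intr g = \prod_(x <- rs) ('X - x%:P) -> uniq rs /\ all_transpositions rs.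
Proof.
move=> pr1 pr2 pr3 c1 c2 s2 c3 s3 gE.
have [Urs trans1] := frobenius_transitive pr1 gE c1; split=> //.
have [x xrs trans2] := frobenius_stabilizer pr2 gE Urs c2 s2.
apply: (all_transpositions_of_doubly_transitive _ xrs trans1 trans2).
  exact: (gal_roots_stable gE).
exact: (frobenius_transposition pr3 gE Urs c3 s3).
Qed.

(** * Certificates by computation with integer polynomials *)

(* Integer polynomials as lists of coefficients, constant term first. *)
Fixpoint zp_add (a b : seq Z) : seq Z :=
  match a, b with
  | [::], _ => b
  | _, [::] => a
  | x :: a', y :: b' => Z.add x y :: zp_add a' b'
  end.
Definition zp_scale (c : Z) (a : seq Z) : seq Z := map (Z.mul c) a.
Definition zp_sub (a b : seq Z) : seq Z := zp_add a (zp_scale (Z.opp Z.one) b).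
Fixpoint zp_mul (a b : seq Z) : seq Z :=
  if a is x :: a' then zp_add (zp_scale x b) (Z0 :: zp_mul a' b) else [::].
Fixpoint zp_deriv (a : seq Z) : seq Z :=
  if a is x :: a' then zp_add a' (Z0 :: zp_deriv a') else [::].

(* Arithmetic modulo the integer [M] and the monic polynomial of degree [n]
   whose lower coefficients are those of [f].  As [z mod 0 = z], [M = 0] gives
   arithmetic over the integers.  [zr_red] lowers the degree by one only, which
   is what the Horner scheme of [zr_mul] needs. *)
Section Residues.
Variables (M : Z) (n : nat) (f : seq Z).

Definition zr_red (a : seq Z) : seq Z :=
  map (fun z => Z.modulo z M) (zp_sub (take n a) (zp_mul (drop n a) f)).
Fixpoint zr_mul (a b : seq Z) : seq Z :=
  if a is x :: a' then zr_red (zp_add (zp_scale x b) (Z0 :: zr_mul a' b)) else [::].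
Fixpoint zr_pow (a : seq Z) (e : positive) : seq Z :=
  match e with
  | xH => a
  | xO e' => let b := zr_pow a e' in zr_mul b b
  | xI e' => let b := zr_pow a e' in zr_mul a (zr_mul b b)
  end.
Definition zr_eq (a b : seq Z) : bool :=
  all (fun z => Z.eqb (Z.modulo z M) Z0) (zp_sub a b).
Definition zr_frob (p j : nat) : seq Z :=
  iter j (fun a => zr_pow a (Pos.of_nat p)) [:: Z0; Z.one].
(** A unit test on this product of the residues [X^(p^j) - X] excludes all coincidences
    [y ^+ (p ^ j) = y] with [0 < j < m] at once. *)
Definition zr_frob_prod (p m : nat) : seq Z :=
  foldr (fun j a => zr_mul (zp_sub (zr_frob p j) [:: Z0; Z.one]) a) [:: Z.one] (iota 1 m.-1).
End Residues.

Section Evaluation.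
Variables (A : comNzRingType) (phi : {rmorphism Z -> A}) (y : A).

Definition zp_eval (a : seq Z) : A := foldr (fun c r => phi c + y * r) 0 a.

Lemma zp_eval_add a b : zp_eval (zp_add a b) = zp_eval a + zp_eval b.
Proof.
elim: a b => [|x a IH] [|z b] /=; rewrite ?add0r ?addr0 //.
by rewrite IH [phi _](rmorphD phi); ring.
Qed.

Lemma zp_eval_scale c a : zp_eval (zp_scale c a) = phi c * zp_eval a.
Proof.
elim: a => [|x a IH] /=; first by rewrite mulr0.
by rewrite IH [phi _](rmorphM phi); ring.
Qed.

Lemma zp_eval_sub a b : zp_eval (zp_sub a b) = zp_eval a - zp_eval b.
Proof. by rewrite zp_eval_add zp_eval_scale (rmorphN1 phi) mulN1r. Qed.

Lemma zp_eval_mul a b : zp_eval (zp_mul a b) = zp_eval a * zp_eval b.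
Proof.
elim: a => [|x a IH] /=; first by rewrite mul0r.
by rewrite zp_eval_add zp_eval_scale /= IH [phi Z0](rmorph0 phi); ring.
Qed.

Lemma zp_eval_take_drop n a : zp_eval a = zp_eval (take n a) + y ^+ n * zp_eval (drop n a).
Proof.
elim: n a => [|n IH] [|x a]; rewrite ?take0 ?drop0 ?expr0 /= ?mulr0 ?mul1r ?add0r ?addr0 //.
by rewrite (IH a) exprS; ring.
Qed.

Variables (M : Z) (n : nat) (f : seq Z).
Hypotheses (phiM : phi M = 0) (yf : zp_eval f + y ^+ n = 0).

Lemma zp_eval_mod a : zp_eval (map (fun z => Z.modulo z M) a) = zp_eval a.
Proof.
elim: a => //= x a ->; congr (_ + _).
have [->|M0] := eqVneq M Z0; first by rewrite Zmod_0_r.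
rewrite [in RHS](Z.div_mod x M); last exact/eqP.
by rewrite [RHS](rmorphD phi) [X in X + _](rmorphM phi) phiM mul0r add0r.
Qed.

Lemma zr_eval_red a : zp_eval (zr_red M n f a) = zp_eval a.
Proof.
rewrite zp_eval_mod zp_eval_sub zp_eval_mul [RHS](zp_eval_take_drop n).
by rewrite -[y ^+ n](addKr (zp_eval f)) yf addr0; ring.
Qed.

Lemma zr_eval_mul a b : zp_eval (zr_mul M n f a b) = zp_eval a * zp_eval b.
Proof.
elim: a => [|x a IH]; first by rewrite /= mul0r.
rewrite [zr_mul _ _ _ _ _]/= zr_eval_red zp_eval_add zp_eval_scale /= IH.
by rewrite [phi Z0](rmorph0 phi); ring.
Qed.

Lemma zr_eval_pow a e : zp_eval (zr_pow M n f a e) = zp_eval a ^+ Pos.to_nat e.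
Proof.
elim: e => [e IH|e IH|] /=; last by rewrite expr1.
  have -> : Pos.to_nat e~1 = (Pos.to_nat e * 2).+1 by lia.
  by rewrite !zr_eval_mul IH exprS exprM expr2.
have -> : Pos.to_nat e~0 = (Pos.to_nat e * 2)%N by lia.
by rewrite zr_eval_mul IH exprM expr2.
Qed.

Lemma zr_eval_eq a b : zr_eq M a b -> zp_eval a = zp_eval b.
Proof.
rewrite /zr_eq => ab0; apply/eqP; rewrite -subr_eq0 -zp_eval_sub -zp_eval_mod.
elim: (zp_sub a b) ab0 => //= x s IH /andP[/Z.eqb_spec -> /IH /eqP ->].
by rewrite [phi Z0](rmorph0 phi) mulr0 addr0.
Qed.

Lemma zp_eval_X : zp_eval [:: Z0; Z.one] = y.
Proof. by rewrite /= [phi Z0](rmorph0 phi) [phi Z.one](rmorph1 phi); ring. Qed.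

Lemma zp_eval_1 : zp_eval [:: Z.one] = 1.
Proof. by rewrite /= [phi Z.one](rmorph1 phi); ring. Qed.

Lemma zr_eval_frob p j : (0 < p)%N -> zp_eval (zr_frob M n f p j) = y ^+ (p ^ j).
Proof.
move=> p0; elim: j => [|j IH]; first exact: zp_eval_X.
rewrite [zr_frob _ _ _ _ _]iterS -/(zr_frob M n f p j) zr_eval_pow IH.
by rewrite Nat2Pos.id; [rewrite -exprM expnSr | lia].
Qed.

Lemma zr_eval_frob_prod0 p m j : (0 < p)%N -> (0 < j < m)%N -> y ^+ (p ^ j) = y ->
  zp_eval (zr_frob_prod M n f p m) = 0.
Proof.
move=> p0 jm yj; have : j \in iota 1 m.-1 by rewrite mem_iota; lia.
rewrite /zr_frob_prod; elim: (iota 1 m.-1) => //= i s IH.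
rewrite in_cons zr_eval_mul => /predU1P[<-|/IH ->]; last by rewrite mulr0.
by rewrite zp_eval_sub zp_eval_X zr_eval_frob // yj subrr mul0r.
Qed.

Lemma zr_eval_pow0 a e : zp_eval a = 0 -> zp_eval (zr_pow M n f a e) = 0.
Proof.
move=> a0; rewrite zr_eval_pow a0 expr0n.
by case: (Pos.to_nat e) (Pos2Nat.is_pos e) => //; lia.
Qed.

Lemma zr_unit a e : zr_eq M (zr_pow M n f a e) [:: Z.one] -> zp_eval a != 0.
Proof.
move=> /zr_eval_eq; rewrite zp_eval_1 => pow1.
apply/eqP=> /(zr_eval_pow0 e); rewrite pow1; exact/eqP/oner_neq0.
Qed.

End Evaluation.

Section ZtoRing.
Variable A : comNzRingType.
Definition Zring (z : Z) : A := (int_of_Z z)%:~R.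
Fact Zring_zmod : zmod_morphism Zring.
Proof. by move=> x z; rewrite /Zring !rmorphB. Qed.
Fact Zring_monoid : monoid_morphism Zring.
Proof. by split=> [|x z]; rewrite /Zring ?rmorph1 ?rmorphM. Qed.
HB.instance Definition _ := GRing.isZmodMorphism.Build Z A Zring Zring_zmod.
HB.instance Definition _ := GRing.isMonoidMorphism.Build Z A Zring Zring_monoid.
End ZtoRing.

Definition zp_poly (a : seq Z) : {poly int} := Poly (map int_of_Z a).

Lemma zp_poly_cons x a : zp_poly (x :: a) = zp_poly a * 'X + (int_of_Z x)%:P.
Proof. by rewrite /zp_poly /= cons_poly_def. Qed.

Lemma horner_zp_poly (A : comNzRingType) (a : seq Z) (y : A) :
  (map_poly intr (zp_poly a)).[y] = zp_eval (Zring A) y a.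
Proof.
elim: a => [|x a IH]; first by rewrite rmorph0 horner0.
rewrite zp_poly_cons rmorphD rmorphM /= map_polyX map_polyC /=.
by rewrite hornerMXaddC IH mulrC addrC.
Qed.

Lemma zp_poly_add a b : zp_poly (zp_add a b) = zp_poly a + zp_poly b.
Proof.
elim: a b => [|x a IH] [|z b] /=; rewrite ?add0r ?addr0 //.
by rewrite !zp_poly_cons IH [int_of_Z _](rmorphD int_of_Z) polyCD; ring.
Qed.

Lemma deriv_zp_poly a : (zp_poly a)^`() = zp_poly (zp_deriv a).
Proof.
elim: a => [|x a IH]; first exact: deriv0.
rewrite zp_poly_cons derivD derivM derivX derivC IH /= zp_poly_add zp_poly_cons.
by rewrite [int_of_Z Z0](rmorph0 int_of_Z) polyC0; ring.
Qed.

Section Checkers.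
Variables (f : seq Z) (p : nat).
Let n := size f.
Let M := Z.of_nat p.
Let fp := map (fun z => Z.modulo z M) f.
Definition zp_monic := rcons f Z.one.
Local Notation g := (zp_poly zp_monic).
Local Notation X := [:: Z0; Z.one].

(* A residue having some power equal to 1 is invertible, so with a multiple [e] of
   the orders of the units as exponent no explicit inverses are needed. *)
Definition check_simple (e : positive) : bool :=
  zr_eq M (zr_pow M n fp (zp_deriv zp_monic) e) [:: Z.one].

Definition check_one_cycle (e : positive) : bool :=
  zr_eq M (zr_pow M n fp (zr_frob_prod M n fp p n) e) [:: Z.one].

(** The first test is the Horner value at [r]. In the second, the factor [X - r] absorbs the root
    [r]; at any other root the [e]-th power of the product must be 1. *)
Definition check_fixed_point (r : Z) (e : positive) : bool :=
  zr_eq M [:: foldr (fun c s => Z.add c (Z.mul r s)) Z0 zp_monic] [::] &&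
  zr_eq M (zr_mul M n fp [:: Z.opp r; Z.one]
    (zp_sub [:: Z.one] (zr_pow M n fp (zr_frob_prod M n fp p n.-1) e))) [::].

(** The monic polynomial [rcons v Z.one], of degree at most 2, annihilates the residue [u] of
    [X^(p^m) - X]; so it vanishes at every root moved by the [m]-th power of the Frobenius. *)
Definition check_transposition (m : nat) (v : seq Z) : bool :=
  let u := zp_sub (zr_frob M n fp p m) [:: Z0; Z.one] in
  [&& (size u <= n)%N, has (fun z => ~~ Z.eqb (Z.modulo z M) Z0) u, (size v <= 2)%N &
      zr_eq M (zr_mul M n fp u (rcons v Z.one)) [::]].

Lemma size_zp_monic : size g = n.+1.
Proof.
have : last 1 (map int_of_Z zp_monic) != 0 by rewrite /zp_monic map_rcons last_rcons.
by move=> /PolyK; rewrite /zp_poly => ->; rewrite size_map size_rcons.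
Qed.

Lemma zp_monic_monic : g \is monic.
Proof.
have szg := size_zp_monic.
rewrite monicE lead_coefE szg /zp_poly coef_Poly /= (nth_map Z0) ?size_rcons //.
by rewrite nth_rcons ltnn eqxx.
Qed.

Section Field.
Variables (k : fieldType) (y : k).
Hypothesis charp : p \in [pchar k].
Local Notation ev := (zp_eval (Zring k)).

Lemma Zring_char : Zring k M = 0.
Proof.
rewrite /Zring /M -[Z.of_nat p]/(Z_of_int p) Z_of_intK.
by rewrite -[_%:~R]/(p%:R) pcharf0.
Qed.

Lemma Zring_eq0 z : Zring k z = 0 -> Z.modulo z M = Z0.
Proof.
have p0 : (0 < p)%N by rewrite prime_gt0 // (pcharf_prime charp).
rewrite -[Zring k z]addr0 -[X in _ + X](mulr0 0).
have := zp_eval_mod 0 Zring_char [:: z]; rewrite /= => <-.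
have [m mE] : exists m, Z.modulo z M = Z.of_nat m.
  by exists (Z.to_nat (Z.modulo z M)); rewrite Z2Nat.id //; apply: (Z.mod_pos_bound z M _).1; lia.
have : (m < p)%N by have := Z.mod_pos_bound z M; lia.
rewrite mE mulr0 addr0 /Zring -[Z.of_nat m]/(Z_of_int m) Z_of_intK -[_%:~R]/(m%:R).
by case: m mE => // m _ ltmp /eqP; rewrite -(dvdn_pcharf charp) gtnNdvd.
Qed.

Lemma eval_rcons s c : ev y (rcons s c) = ev y s + y ^+ size s * Zring k c.
Proof.
elim: s => [|x s IH] /=; first by rewrite mulr0 addr0 add0r mul1r.
by rewrite IH exprS; ring.
Qed.

Lemma root_zp_monic : root (map_poly intr g) y = (ev y fp + y ^+ n == 0).
Proof.
rewrite /root horner_zp_poly eval_rcons [Zring k _](rmorph1 (Zring k)) mulr1.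
by rewrite (zp_eval_mod _ Zring_char).
Qed.
End Field.

Local Notation p_gt0 charp := (prime_gt0 (pcharf_prime charp)).

Lemma check_simpleP e : check_simple e -> simple_roots_mod g p.
Proof.
move=> chk k y charp; rewrite root_zp_monic // => /eqP gy.
rewrite deriv_map deriv_zp_poly horner_zp_poly.
exact: (zr_unit (Zring_char charp) gy chk).
Qed.

Lemma check_one_cycleP e : check_one_cycle e -> one_cycle_mod g p.
Proof.
move=> chk k y charp; rewrite root_zp_monic // size_zp_monic => /eqP gy j jn.
apply: contraTneq (zr_unit (Zring_char charp) gy chk) => yj.
by rewrite (zr_eval_frob_prod0 (Zring_char charp) gy (p_gt0 charp) jn) ?eqxx.
Qed.

Lemma check_fixed_pointP r e : check_fixed_point r e -> fixed_point_cycle_mod g p (int_of_Z r).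
Proof.
case/andP=> chk_r chk k y charp; split.
  rewrite /root horner_zp_poly -[_%:~R]/(Zring k r).
  move/(zr_eval_eq 0 (Zring_char charp)): chk_r; rewrite /= mulr0 addr0 => <-.
  apply/eqP/esym; elim: zp_monic => [|c s /= <-]; first exact: rmorph0.
  by rewrite [LHS](rmorphD (Zring k)) [X in _ + X](rmorphM (Zring k)).
rewrite root_zp_monic // size_zp_monic => /eqP gy yr j jn.
move/(zr_eval_eq y (Zring_char charp)): chk.
rewrite (zr_eval_mul (Zring_char charp) gy) => /eqP; rewrite mulf_eq0.
have -> : zp_eval (Zring k) y [:: Z.opp r; Z.one] = y - (int_of_Z r)%:~R.
  rewrite /= [Zring k (Z.opp r)](rmorphN (Zring k)) [Zring k Z.one](rmorph1 (Zring k)).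
  by rewrite /Zring; ring.
rewrite subr_eq0 (negPf yr) zp_eval_sub zp_eval_1 /=.
apply: contraTneq => yj; rewrite (zr_eval_pow0 (Zring_char charp) gy) ?subr0 ?oner_neq0 //.
exact: (zr_eval_frob_prod0 (Zring_char charp) gy (p_gt0 charp) jn).
Qed.

Lemma check_transpositionP m v : check_transposition m v -> transposition_mod g p m.
Proof.
rewrite /check_transposition; set u := zp_sub _ _ => /and4P[szu u0 szv uv] k charp.
have horner_Poly s (y : k) : (Poly (map (Zring k) s)).[y] = zp_eval (Zring k) y s.
  by rewrite horner_Poly /=; elim: s => //= x s ->; rewrite addrC mulrC.
exists (Poly (map (Zring k) u)), (Poly (map (Zring k) (rcons v Z.one))); split.
- case/hasP: u0 => z /(nthP Z0)[i ilt <-] ui.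
  apply/eqP=> /(congr1 (fun q : {poly k} => q`_i)); rewrite coef_Poly coef0 (nth_map Z0) // => ui0.
  by move: ui; rewrite (Zring_eq0 charp ui0).
- by rewrite size_zp_monic ltnS (leq_trans (size_Poly _)) // size_map.
- apply/eqP=> /(congr1 (fun q : {poly k} => q`_(size v))); rewrite coef_Poly coef0.
  rewrite (nth_map Z0) ?size_rcons // nth_rcons ltnn eqxx [Zring k Z.one](rmorph1 (Zring k)).
  by apply/eqP/oner_neq0.
- by rewrite (leq_trans (size_Poly _)) // size_map size_rcons ltnS.
move=> y; rewrite root_zp_monic // => /eqP gy; rewrite !horner_Poly; split.
  by rewrite zp_eval_sub (zr_eval_frob (Zring_char charp) gy) ?(p_gt0 charp) // zp_eval_X.
move/(zr_eval_eq y (Zring_char charp)): uv => /=.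
rewrite (zr_eval_mul (Zring_char charp) gy) => /eqP; rewrite mulf_eq0.
by case/orP=> /eqP; [left | right].
Qed.

End Checkers.

(** * The polynomial of the paw and one of its real roots *)

(* With its leading coefficient 1, the minimal polynomial of [6 m], where
   [m = 1 / |p0 - p2| - 1] at the equilibrium [p] of the paw. *)
Definition paw_coefs : seq Z := [:: 78364164096; 3095384481792; 30875662052352; 22033481504256;
  -22123950240960; -4186473532992; 7860137474736; -2528463600000; 457532277516; -46541995092;
  1784630745; 98545896; 1828752; 2652]%ZZ.

Definition paw_poly : {poly int} := zp_poly (zp_monic paw_coefs).

Lemma paw_root_not_radical (C : numClosedFieldType) (x : C) :
  root (map_poly intr paw_poly) x -> ~ radical x.
Proof.
move=> px; apply: (root_not_radical (zp_monic_monic _) _ px) => [|L rs].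
  by rewrite size_zp_monic.
(* The factors of [paw_poly] have degrees 14 modulo 89, 1 and 13 modulo 67, and
   1, 2 and 11 modulo 113. *)
pose e2 := Z.to_pos (67 ^ 13 - 1)%ZZ.
pose e3 := Z.to_pos ((113 ^ 2 - 1) * (113 ^ 11 - 1))%ZZ.
apply: (@symmetric_of_frobenius _ 89 67 113 14 11) => //.
- by apply: (@check_one_cycleP _ _ (Z.to_pos (89 ^ 14 - 1)%ZZ)); vm_compute.
- by apply: (@check_fixed_pointP _ _ 14%ZZ e2); vm_compute.
- by apply: (@check_simpleP _ _ e2); vm_compute.
(* [X^2 + 90 X + 36] is the quadratic factor modulo 113. The 11th power of the Frobenius fixes the
   roots of the other factors and, 11 being odd, swaps the two roots of this one. *)
- by apply: (@check_transpositionP _ _ 11 [:: 36; 90]%ZZ); vm_compute.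
- by apply: (@check_simpleP _ _ e3); vm_compute.
Qed.

(* Interval Horner scheme on [[a/d, b/d]]: returns [(w, l, u)] such that the
   value of the polynomial lies between [l/w] and [u/w]. *)
Fixpoint zp_bounds (a b d : Z) (s : seq Z) : Z * Z * Z :=
  if s is c :: s' then
    let: (w, l, u) := zp_bounds a b d s' in
    let w' := Z.mul d w in
    (w', Z.add (Z.mul c w') (Z.min (Z.min (Z.mul a l) (Z.mul a u)) (Z.min (Z.mul b l) (Z.mul b u))),
         Z.add (Z.mul c w') (Z.max (Z.max (Z.mul a l) (Z.mul a u)) (Z.max (Z.mul b l) (Z.mul b u))))
  else (Z.one, Z0, Z0).

Section Bounds.
Variable R : realFieldType.
Local Notation phi := (Zring R).

Lemma Zring_le (a b : Z) : (a <= b)%ZZ -> phi a <= phi b.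
Proof. by move=> ab; rewrite ler_int; lia. Qed.

Lemma Zring_lt (a b : Z) : (a < b)%ZZ -> phi a < phi b.
Proof. by move=> ab; rewrite ltr_int; lia. Qed.

(** The product is monotone in each variable once the other is fixed, so its extremes over a
    rectangle occur at the corners. *)
Lemma mul_bounds (a b l u lo hi x y : R) : a <= x <= b -> l <= y <= u ->
  lo <= a * l -> lo <= a * u -> lo <= b * l -> lo <= b * u ->
  a * l <= hi -> a * u <= hi -> b * l <= hi -> b * u <= hi -> lo <= x * y <= hi.
Proof.
move=> /andP[ax xb] /andP[ly yu] ? ? ? ? ? ? ? ?.
have side t : lo <= a * t -> lo <= b * t -> a * t <= hi -> b * t <= hi ->
    lo <= x * t /\ x * t <= hi.
  move=> lat lbt hat hbt; have [t0|t0] := lerP 0 t.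
    have := ler_wpM2r t0 ax; have := ler_wpM2r t0 xb; split; lra.
  have := ler_wnM2r (ltW t0) ax; have := ler_wnM2r (ltW t0) xb; split; lra.
have [||||lxl xlh] := side l => //; have [||||lxu xuh] := side u => //.
have [x0|x0] := lerP 0 x.
  have := ler_wpM2l x0 ly; have := ler_wpM2l x0 yu; lra.
have := ler_wnM2l (ltW x0) ly; have := ler_wnM2l (ltW x0) yu; lra.
Qed.

Lemma zp_bounds_pos a b d s : (0 < d)%ZZ -> (0 < (zp_bounds a b d s).1.1)%ZZ.
Proof. by move=> d0; elim: s => //= c s; case: zp_bounds => [[w l] u] /= w0; lia. Qed.

Lemma zp_boundsP a b d s x : (0 < d)%ZZ -> phi a <= phi d * x <= phi b ->
  let: (w, l, u) := zp_bounds a b d s in phi l <= phi w * zp_eval phi x s <= phi u.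
Proof.
move=> d0 xab; elim: s => [|c s IH] /=; first by rewrite mulr0 [phi Z0](rmorph0 phi) lexx.
have := zp_bounds_pos a b s d0; case: zp_bounds IH => [[w l] u] IH /= w0.
have M i j : phi (Z.mul i j) = phi i * phi j := rmorphM phi i j.
have D i j : phi (Z.add i j) = phi i + phi j := rmorphD phi i j.
set lo := Z.min _ _; set hi := Z.max _ _.
have /andP[] : phi lo <= (phi d * x) * (phi w * zp_eval phi x s) <= phi hi.
  by apply: (mul_bounds xab IH); rewrite -M; apply: Zring_le; lia.
by rewrite !D !M mulrDr => lo_le le_hi; apply/andP; split; lra.
Qed.

Definition zp_neg a b d s := (0 <? d)%ZZ && ((zp_bounds a b d s).2 <? 0)%ZZ.

Lemma zp_negP a b d s x : zp_neg a b d s -> phi a <= phi d * x <= phi b -> zp_eval phi x s < 0.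
Proof.
case/andP=> /Z.ltb_spec0 d0 /Z.ltb_spec0 neg xab.
have := zp_boundsP s d0 xab; have := zp_bounds_pos a b s d0.
case: zp_bounds neg => [[w l] u] /= u0 w0 /andP[_ le_u].
rewrite -(pmulr_rlt0 _ (Zring_lt w0)); apply: le_lt_trans le_u _.
by have := Zring_lt u0; rewrite [phi Z0](rmorph0 phi).
Qed.
End Bounds.

Definition paw_dcoefs : seq Z := zp_scale 129%ZZ (zp_deriv (zp_monic paw_coefs)).
Definition paw_ncoefs : seq Z := [:: -561453114359808; -9089332777322496; -2186479901306880;
  7926776982392832; -1551494959964352; -1712933964127584; 971957514610944; -191439986439024;
  19639422470772; -919898662518; -34941312522; 177289284; -4221348; -3550]%ZZ.

(* The two equilibrium equations of [paw_parameters] for [m = X / 6] and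
   [n = A / B], cleared of denominators and reduced modulo [f]. *)
Section PawResidues.
Variables (k : nat) (f X A B : seq Z).
Local Notation mul := (zr_mul Z0 k f).
Definition zr_sqr (a : seq Z) : seq Z := mul a a.
(** With [m = X / 6] and [n = A / B], [paw_T] is [6 B (2 m n - m - n)] and [paw_S] is
    [6 B (2 - m - n)]. *)
Definition paw_T := zp_sub (zp_sub (zp_scale 2 (mul X A)) (mul X B)) (zp_scale 6 A).
Definition paw_S := zp_sub (zp_sub (zp_scale 12 B) (mul X B)) (zp_scale 6 A).
Definition paw_residue1 : seq Z :=
  zp_sub (mul (zr_sqr (zp_add X (zp_scale 6 [:: Z.one])))
    (zp_add (zr_sqr (mul paw_T B)) (zr_sqr (mul A paw_S)))) (zr_sqr (mul paw_S paw_T)).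
Definition paw_residue2 : seq Z :=
  zp_sub (mul (zr_sqr (zp_add B (zp_scale 4 A)))
    (zp_add (zp_scale 36 (zr_sqr paw_T)) (zr_sqr (mul X paw_S))))
    (zp_scale 4 (zr_sqr (mul paw_S paw_T))).
End PawResidues.

Section SmallConstants.
Variable R : comNzRingType.
Lemma Zring_nat i : Zring R (Z.of_nat i) = i%:R.
Proof. by rewrite /Zring -[Z.of_nat i]/(Z_of_int i) Z_of_intK. Qed.
Lemma Zring_oppnat i : Zring R (Z.opp (Z.of_nat i)) = - i%:R.
Proof. by apply: etrans (rmorphN (Zring R) _) _; rewrite -Zring_nat. Qed.
End SmallConstants.

Lemma paw_residuesP (R : comNzRingType) (k : nat) (f X A B : seq Z) (y : R)
    (ev := zp_eval (Zring R) y) (x := ev X) (a := ev A) (b := ev B)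
    (t := 2 * (x * a) - x * b - 6 * a) (s := 12 * b - x * b - 6 * a) :
  ev f + y ^+ k = 0 ->
  zr_eq Z0 (paw_residue1 k f X A B) [::] -> zr_eq Z0 (paw_residue2 k f X A B) [::] ->
  (x + 6) ^+ 2 * ((t * b) ^+ 2 + (a * s) ^+ 2) = (s * t) ^+ 2 /\
  (b + 4 * a) ^+ 2 * (36 * t ^+ 2 + (x * s) ^+ 2) = 4 * (s * t) ^+ 2.
Proof.
move=> yf; have phi0 : Zring R Z0 = 0 := rmorph0 (Zring R).
have mulE := zr_eval_mul phi0 yf; pose phi : {rmorphism Z -> R} := Zring R.
have z2 : phi 2%ZZ = 2 := Zring_nat R 2; have z4 : phi 4%ZZ = 4 := Zring_nat R 4.
have z6 : phi 6%ZZ = 6 := Zring_nat R 6; have z12 : phi 12%ZZ = 12 := Zring_nat R 12.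
have z36 : phi 36%ZZ = 36 := Zring_nat R 36.
have zN1 : phi (- Z.one)%ZZ = -1 := rmorphN1 phi.
move=> /(zr_eval_eq y phi0) /eqP eq1 /(zr_eval_eq y phi0) /eqP eq2; split.
  move: eq1; rewrite zp_eval_sub subr_eq0 /zr_sqr !(zp_eval_add, zp_eval_scale, mulE).
  by rewrite zp_eval_1 z2 z6 z12 mulr1 zN1 !mulN1r -!expr2 => /eqP.
move: eq2; rewrite zp_eval_sub subr_eq0 /zr_sqr !(zp_eval_add, zp_eval_scale, mulE).
by rewrite z2 z4 z6 z12 z36 zN1 !mulN1r -!expr2 => /eqP.
Qed.

Lemma paw_residue1_0 :
  zr_eq Z0 (paw_residue1 14 paw_coefs [:: Z0; Z.one] paw_ncoefs paw_dcoefs) [::].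
Proof. by vm_compute. Qed.

Lemma paw_residue2_0 :
  zr_eq Z0 (paw_residue2 14 paw_coefs [:: Z0; Z.one] paw_ncoefs paw_dcoefs) [::].
Proof. by vm_compute. Qed.

(** The polynomial is positive at [a / d] and negative at [b / d], so a root [x = 6 m] lies between.
    With [A], [B] the values of [paw_ncoefs], [paw_dcoefs], the remaining tests give [B < 0], then
    [4/1000 < A / B < 5/1000], then [-0.066 < x < -0.060]. *)
Lemma paw_signs (a := (-629073)%ZZ) (b := (-629072)%ZZ) (d := 10000000%ZZ) :
  [&& (a <=? b)%ZZ, zp_neg a a d (zp_scale (Z.opp Z.one) (zp_monic paw_coefs)),
      zp_neg b b d (zp_monic paw_coefs), zp_neg a b d paw_dcoefs,
      zp_neg a b d (zp_sub (zp_scale 1000 paw_ncoefs) (zp_scale 4 paw_dcoefs)),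
      zp_neg a b d (zp_sub (zp_scale 5 paw_dcoefs) (zp_scale 1000 paw_ncoefs)),
      zp_neg a b d [:: 60; 1000]%ZZ & zp_neg a b d [:: -66; -1000]%ZZ].
Proof. by vm_compute. Qed.

Lemma zp_ivt (R : rcfType) (a b d : Z) (s : seq Z) : (a <= b)%ZZ ->
  zp_neg a a d (zp_scale (Z.opp Z.one) s) -> zp_neg b b d s ->
  exists2 x : R, Zring R a <= Zring R d * x <= Zring R b & zp_eval (Zring R) x s = 0.
Proof.
pose phi := Zring R => /(Zring_le R) ab neg_a neg_b.
have d0 : 0 < phi d.
  by rewrite -[0](rmorph0 phi); apply: Zring_lt; case/andP: neg_a => /Z.ltb_spec0.
have dK c : phi d * (phi c / phi d) = phi c by rewrite mulrC divfK // gt_eqF.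
have sign_a : zp_eval phi (phi a / phi d) (zp_scale (Z.opp Z.one) s) < 0.
  by apply: (zp_negP neg_a); rewrite -/phi dK lexx.
have sign_b : zp_eval phi (phi b / phi d) s < 0.
  by apply: (zp_negP neg_b); rewrite -/phi dK lexx.
have [||x xint] := @poly_ivt R (- map_poly intr (zp_poly s)) (phi a / phi d) (phi b / phi d).
- by rewrite ler_pM2r ?invr_gt0.
- rewrite !hornerN !horner_zp_poly oppr_le0 oppr_ge0 (ltW sign_b) andbT.
  by move: sign_a; rewrite zp_eval_scale (rmorphN1 phi) mulN1r oppr_lt0 => /ltW.
rewrite rootN /root horner_zp_poly => /eqP px; exists x => //.
by case/andP: xint; rewrite ler_pdivrMr // ler_pdivlMr // ![_ * phi d]mulrC => -> ->.
Qed.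

Lemma paw_root (R : rcfType) (ev := zp_eval (Zring R)) : exists x : R,
  ev x (zp_monic paw_coefs) = 0 /\
  [/\ ev x paw_dcoefs < 0, 1000 * ev x paw_ncoefs < 4 * ev x paw_dcoefs,
      5 * ev x paw_dcoefs < 1000 * ev x paw_ncoefs,
      60 + 1000 * x < 0 & 0 < 66 + 1000 * x].
Proof.
have := paw_signs; move: (Z.neg 629073) (Z.neg 629072) (Z.pos 10000000) => a b d.
move=> /and5P[/Z.leb_spec0 ab neg_lo neg_hi neg_B /and4P[le_n ge_n le_m ge_m]].
have [x xab px] := zp_ivt R ab neg_lo neg_hi; exists x; split=> //.
pose phi : {rmorphism Z -> R} := Zring R.
have z5 : phi 5%ZZ = 5 := Zring_nat R 5; have z4 : phi 4%ZZ = 4 := Zring_nat R 4.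
have z1000 : phi 1000%ZZ = 1000 := Zring_nat R 1000; have z60 : phi 60%ZZ = 60 := Zring_nat R 60.
have zN1000 : phi (-1000)%ZZ = - 1000 := Zring_oppnat R 1000.
have zN66 : phi (-66)%ZZ = - 66 := Zring_oppnat R 66.
have evc c s : ev x (c :: s) = phi c + x * ev x s by [].
have ev0 : ev x [::] = 0 by [].
have evn : ev x [:: 60; 1000]%ZZ = 60 + 1000 * x.
  by rewrite !evc ev0 z60 z1000; ring.
have evp : ev x [:: -66; -1000]%ZZ = - (66 + 1000 * x).
  by rewrite !evc ev0 zN66 zN1000; ring.
have subE c e s t : ev x (zp_sub (zp_scale c s) (zp_scale e t)) = phi c * ev x s - phi e * ev x t.
  by rewrite /ev zp_eval_sub !zp_eval_scale.
have := zp_negP le_n xab; have := zp_negP ge_n xab.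
rewrite -/ev !subE z5 z4 z1000 !subr_lt0 => ge_n' le_n'.
split=> //; first exact: zp_negP neg_B xab.
  by rewrite -evn; apply: zp_negP le_m xab.
by rewrite -oppr_lt0 -evp; apply: zp_negP ge_m xab.
Qed.

(* With [c = - (m + n) / 2], the last two equations express [|p0 - p2| = 1 / (1 + m)]
   and [|p0 - p3| = 2 / (1 + 4 n)] for the placement of [paw_equilibrium].  In the
   field generated by [6 m], the number [n] is [A / (129 f')] where [A] has the
   coefficients [paw_ncoefs] and [f'] is the derivative of [paw_poly]. *)
Lemma paw_parameters (R : rcfType) : exists m n : R,
  [/\ root (map_poly intr paw_poly) (6 * m),
     - (11 / 1000) < m < - (10 / 1000), 4 / 1000 < n < 5 / 1000,
     (1 + m) ^+ 2 * ((2 * m * n - m - n) ^+ 2 + n ^+ 2 * (2 - m - n) ^+ 2)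
       = (2 - m - n) ^+ 2 * (2 * m * n - m - n) ^+ 2 &
     (1 + 4 * n) ^+ 2 * ((2 * m * n - m - n) ^+ 2 + m ^+ 2 * (2 - m - n) ^+ 2)
       = 4 * (2 - m - n) ^+ 2 * (2 * m * n - m - n) ^+ 2].
Proof.
have [x [px [B0 le_n ge_n le_m ge_m]]] := paw_root R.
have yf : zp_eval (Zring R) x paw_coefs + x ^+ 14 = 0.
  by move: px; rewrite eval_rcons [Zring R Z.one](rmorph1 (Zring R)) mulr1.
have [eq1 eq2] := paw_residuesP yf paw_residue1_0 paw_residue2_0.
move: eq1 eq2 B0 le_n ge_n; rewrite zp_eval_X.
move: (zp_eval _ x paw_ncoefs) (zp_eval _ x paw_dcoefs) => A B eq1 eq2 B0 le_n ge_n.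
have Bn0 : B != 0 by rewrite lt_eqF.
exists (x / 6), (A / B).
have x6 : 6 * (x / 6) = x by field.
have AB : B * (A / B) = A by field.
split.
- by rewrite x6 /root horner_zp_poly; apply/eqP.
- by apply/andP; split; lra.
- by rewrite ltr_ndivlMr // ltr_ndivrMr //; apply/andP; split; lra.
(* [1296 * B ^+ 4] is the fourth power of [6 * B], the denominator left by [m = x / 6] and
   [n = A / B]. *)
- apply: (@mulfI _ (1296 * B ^+ 4)); first by rewrite mulf_neq0 ?expf_neq0 // pnatr_eq0.
  transitivity ((x + 6) ^+ 2 * (((2 * (x * A) - x * B - 6 * A) * B) ^+ 2
      + (A * (12 * B - x * B - 6 * A)) ^+ 2)).
    by field.
  by rewrite eq1; field.
apply: (@mulfI _ (1296 * B ^+ 4)); first by rewrite mulf_neq0 ?expf_neq0 // pnatr_eq0.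
transitivity ((B + 4 * A) ^+ 2 * (36 * (2 * (x * A) - x * B - 6 * A) ^+ 2
    + (x * (12 * B - x * B - 6 * A)) ^+ 2)).
  by field.
by rewrite eq2; field.
Qed.

(** * The Kamada-Kawai energy of the paw *)

Lemma gdist_adjacent (n : nat) (e : rel 'I_n.+2) i j : i != j -> e i j -> gdist e i j = 1%N.
Proof.
move=> ij eij; rewrite /gdist card_ord /= (negPf ij).
by case: existsP => // -[]; exists j; rewrite eij eqxx.
Qed.

Lemma gdist_two (n : nat) (e : rel 'I_n.+3) i j k :
  i != j -> ~~ e i j -> e i k -> e k j -> gdist e i j = 2.
Proof.
move=> ij neij eik ekj; rewrite /gdist card_ord /= (negPf ij).
case: existsP => [[l /andP[eil /eqP lj]]|_]; first by rewrite -lj eil in neij.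
by case: existsP => // -[]; exists k; rewrite eik; apply/existsP; exists j; rewrite ekj eqxx.
Qed.

Definition paw : rel 'I_4 := fun i j =>
  let edge a b := (a, b) \in [:: (0, 1); (0, 2); (1, 2); (2, 3)]%N in
  edge (val i) (val j) || edge (val j) (val i).

Definition v0 : 'I_4 := @Ordinal 4 0 isT.
Definition v1 : 'I_4 := @Ordinal 4 1 isT.
Definition v2 : 'I_4 := @Ordinal 4 2 isT.
Definition v3 : 'I_4 := @Ordinal 4 3 isT.

Lemma paw_simple : simple_graph paw.
Proof.
split=> [i j|i]; first by rewrite /paw orbC.
by case: i => [[|[|[|[|]]]]] //= i4; rewrite /paw.
Qed.

Lemma ord4_cases (P : 'I_4 -> Prop) : P v0 -> P v1 -> P v2 -> P v3 -> forall i, P i.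
Proof.
move=> P0 P1 P2 P3 [[|[|[|[|]]]] // i4].
- by rewrite (_ : Ordinal _ = v0) //; apply: val_inj.
- by rewrite (_ : Ordinal _ = v1) //; apply: val_inj.
- by rewrite (_ : Ordinal _ = v2) //; apply: val_inj.
- by rewrite (_ : Ordinal _ = v3) //; apply: val_inj.
Qed.

Lemma paw_connected : connected_graph paw.
Proof.
have step i j : paw i j -> exists n, walk paw n i j.
  by move=> eij; exists 1%N; apply/existsP; exists j; rewrite eij eqxx.
have via i j : paw i v2 -> paw v2 j -> exists n, walk paw n i j.
  move=> ei ej; exists 2; apply/existsP; exists v2; rewrite ei.
  by apply/existsP; exists j; rewrite ej eqxx.
by do 2![apply: ord4_cases]; first [by exists 0%N; rewrite /= eqxx | exact: step | exact: via].
Qed.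

Lemma paw_energy (p : 'I_4 -> CC) : kk_energy paw p =
  ((cnorm (p v0 - p v1) - 1) ^+ 2 + (cnorm (p v0 - p v2) - 1) ^+ 2
   + (cnorm (p v1 - p v2) - 1) ^+ 2 + (cnorm (p v2 - p v3) - 1) ^+ 2) / 2
  + ((cnorm (p v0 - p v3) - 2) ^+ 2 + (cnorm (p v1 - p v3) - 2) ^+ 2) / 8.
Proof.
rewrite /kk_energy; under eq_bigr => i _ do rewrite big_mkcond /=.
rewrite !big_ord_recl !big_ord0 /=.
have -> : lift ord0 (ord0 : 'I_3) = v1 by apply: val_inj.
have -> : lift ord0 (lift ord0 (ord0 : 'I_2)) = v2 by apply: val_inj.
have -> : lift ord0 (lift ord0 (lift ord0 (ord0 : 'I_1))) = v3 by apply: val_inj.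
have -> : ord0 = v0 by apply: val_inj.
rewrite ![gdist paw v0 v1]gdist_adjacent // ![gdist paw v0 v2]gdist_adjacent //.
rewrite ![gdist paw v1 v2]gdist_adjacent // ![gdist paw v2 v3]gdist_adjacent //.
rewrite ![gdist paw v0 v3](@gdist_two _ _ _ _ v2) // ![gdist paw v1 v3](@gdist_two _ _ _ _ v2) //.
by field.
Qed.

Lemma cnorm_ge0 z : 0 <= cnorm z.
Proof. exact: sqrtr_ge0. Qed.

Lemma cnorm_sqr z w : cnorm (z - w) ^+ 2 =
  (complex.Re z - complex.Re w) ^+ 2 + (complex.Im z - complex.Im w) ^+ 2.
Proof.
case: z w => [a b] [c d]; rewrite /cnorm sqr_sqrtr //=.
by rewrite addr_ge0 // sqr_ge0.
Qed.

(** The left side, a quadratic in [t] without linear term, is tangent to the spring energy at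
    [t = r] because [r * (1 + w) = d]; the gap is [(1 + w) * (t - r) ^+ 2]. *)
Lemma spring_ge (R : realFieldType) (d r t w : R) : 0 <= 1 + w -> r * (1 + w) = d ->
  (r - d) ^+ 2 - w * (t ^+ 2 - r ^+ 2) <= (t - d) ^+ 2.
Proof.
move=> w0 <-; rewrite -subr_ge0.
have -> : (t - r * (1 + w)) ^+ 2 - ((r - r * (1 + w)) ^+ 2 - w * (t ^+ 2 - r ^+ 2)) =
  (1 + w) * (t - r) ^+ 2 by ring.
by rewrite mulr_ge0 // sqr_ge0.
Qed.

(** For weights [l_i] of sum 0, minus the sum over pairs of [l_i l_j (x_i - x_j)^2] is the square of
    the weighted sum. Here the weights are [c, c, m, n], and both sides are divided by [c]. *)
Lemma stress_rank1 (R : realFieldType) (c m n x0 x1 x2 x3 : R) : c != 0 -> 2 * c + m + n = 0 ->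
  - (c * (x0 - x1) ^+ 2 + m * (x0 - x2) ^+ 2 + m * (x1 - x2) ^+ 2 + n * (x0 - x3) ^+ 2
     + n * (x1 - x3) ^+ 2 + m * n / c * (x2 - x3) ^+ 2)
  = (c * x0 + c * x1 + m * x2 + n * x3) ^+ 2 / c.
Proof.
move=> c0 bal; have -> : m = - 2 * c - n by lra.
by field.
Qed.

(* Replacing each spring by the quadratic that touches it at [p] turns the energy
   difference into the quadratic form of the stress matrix of [p].  That matrix
   has rank one and is positive, so [p] is even a global minimum. *)
Lemma paw_minimum (c m n : RR) (p : 'I_4 -> CC) : 0 < c -> 2 * c + m + n = 0 ->
  0 <= 1 + m -> 0 <= 1 + 4 * n -> 0 <= 1 + m * n / c ->
  cnorm (p v0 - p v1) * (1 + c) = 1 ->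
  cnorm (p v0 - p v2) * (1 + m) = 1 -> cnorm (p v1 - p v2) * (1 + m) = 1 ->
  cnorm (p v0 - p v3) * (1 + 4 * n) = 2 -> cnorm (p v1 - p v3) * (1 + 4 * n) = 2 ->
  cnorm (p v2 - p v3) * (1 + m * n / c) = 1 ->
  (forall f : CC -> RR, f = complex.Re (R := RR) \/ f = complex.Im (R := RR) ->
     c * f (p v0) + c * f (p v1) + m * f (p v2) + n * f (p v3) = 0) ->
  forall q, kk_energy paw p <= kk_energy paw q.
Proof.
move=> c0 bal m0 n0 mn0 h01 h02 h12 h03 h13 h23 center q; rewrite !paw_energy.
have c1 : 0 <= 1 + c by lra.
have := spring_ge (cnorm (q v0 - q v1)) c1 h01.
have := spring_ge (cnorm (q v0 - q v2)) m0 h02.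
have := spring_ge (cnorm (q v1 - q v2)) m0 h12.
have := spring_ge (cnorm (q v0 - q v3)) n0 h03.
have := spring_ge (cnorm (q v1 - q v3)) n0 h13.
have := spring_ge (cnorm (q v2 - q v3)) mn0 h23.
rewrite !(cnorm_sqr (q _)) !(cnorm_sqr (p _)).
have cn0 : c != 0 by rewrite gt_eqF.
(* One coordinate at a time: the rank-one form vanishes at [p] by [center], and at [q] it is a
   square divided by [c > 0]. *)
have stress f : f = complex.Re (R := RR) \/ f = complex.Im (R := RR) ->
    c * ((f (q v0) - f (q v1)) ^+ 2 - (f (p v0) - f (p v1)) ^+ 2)
    + m * ((f (q v0) - f (q v2)) ^+ 2 - (f (p v0) - f (p v2)) ^+ 2)
    + m * ((f (q v1) - f (q v2)) ^+ 2 - (f (p v1) - f (p v2)) ^+ 2)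
    + n * ((f (q v0) - f (q v3)) ^+ 2 - (f (p v0) - f (p v3)) ^+ 2)
    + n * ((f (q v1) - f (q v3)) ^+ 2 - (f (p v1) - f (p v3)) ^+ 2)
    + m * n / c * ((f (q v2) - f (q v3)) ^+ 2 - (f (p v2) - f (p v3)) ^+ 2) <= 0.
  move=> fRI; have := stress_rank1 (f (p v0)) (f (p v1)) (f (p v2)) (f (p v3)) cn0 bal.
  rewrite center // expr0n mul0r => eq_p.
  have := stress_rank1 (f (q v0)) (f (q v1)) (f (q v2)) (f (q v3)) cn0 bal.
  have : 0 <= (c * f (q v0) + c * f (q v1) + m * f (q v2) + n * f (q v3)) ^+ 2 / c.
    by rewrite divr_ge0 ?sqr_ge0 // ltW.
  by move: eq_p; set k := m * n / c; lra.
have := stress _ (or_introl erefl); have := stress _ (or_intror erefl).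
by set k := m * n / c; lra.
Qed.

Lemma cnorm_eq z w r : 0 <= r ->
  (complex.Re z - complex.Re w) ^+ 2 + (complex.Im z - complex.Im w) ^+ 2 = r ^+ 2 ->
  cnorm (z - w) = r.
Proof.
by move=> r0; rewrite -cnorm_sqr => /eqP; rewrite eqrXn2 ?cnorm_ge0 // => /eqP.
Qed.

Lemma paw_equilibrium : exists (p : 'I_4 -> CC) (m : RR),
  [/\ kk_equilibrium paw p, cnorm (p v0 - p v2) * (1 + m) = 1
    & root (map_poly intr paw_poly) (6 * m)].
Proof.
have [m [n [+ /andP[m_lo m_hi] /andP[n_lo n_hi] eq1 eq2]]] := paw_parameters RR.
pose c := - (m + n) / 2; set a := 2 - m - n in eq1 eq2; set b := 2 * m * n - m - n in eq1 eq2.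
have c0 : 0 < c by rewrite /c; lra.
have a0 : 0 < a by rewrite /a; lra.
have b0 : 0 < b by rewrite /b; nra.
have m0 : 0 < 1 + m by lra.
have n0 : 0 < 1 + 4 * n by lra.
have cE : 1 + c = a / 2 by rewrite /c /a; field.
have mnE : 1 + m * n / c = b / (2 * c) by rewrite /b /c; field; apply/eqP; lra.
have [[an0 bn0] [mn0 nn0]] : (a != 0 /\ b != 0) /\ (1 + m != 0 /\ 1 + 4 * n != 0).
  by rewrite !gt_eqF.
(* The scales [1 / a] and [1 / b] are forced by the springs [v0 v1] and [v2 v3], through [cE] and
   [mnE]. The heights [n / b] and [- m / b], weighted by [m] and [n], cancel. The remaining springs
   amount to [eq1] and [eq2]. *)
pose p (i : 'I_4) : CC := nth 0 [:: Complex (- a^-1) 0; Complex a^-1 0;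
  Complex 0 (n / b); Complex 0 (- m / b)] i.
have r02 : (1 / a) ^+ 2 + (n / b) ^+ 2 = (1 / (1 + m)) ^+ 2.
  apply: (@mulfI _ ((1 + m) ^+ 2 * a ^+ 2 * b ^+ 2)); first by rewrite !mulf_neq0 ?expf_neq0.
  transitivity ((1 + m) ^+ 2 * (b ^+ 2 + n ^+ 2 * a ^+ 2)); first by field; apply/andP.
  by rewrite eq1; field.
have r03 : (1 / a) ^+ 2 + (m / b) ^+ 2 = (2 / (1 + 4 * n)) ^+ 2.
  apply: (@mulfI _ ((1 + 4 * n) ^+ 2 * a ^+ 2 * b ^+ 2)); first by rewrite !mulf_neq0 ?expf_neq0.
  transitivity ((1 + 4 * n) ^+ 2 * (b ^+ 2 + m ^+ 2 * a ^+ 2)); first by field; apply/andP.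
  by rewrite eq2; field.
have d02 : cnorm (p v0 - p v2) = 1 / (1 + m).
  by apply: cnorm_eq; rewrite ?divr_ge0 ?ltW //= -r02; ring.
have d12 : cnorm (p v1 - p v2) = 1 / (1 + m).
  by apply: cnorm_eq; rewrite ?divr_ge0 ?ltW //= -r02; ring.
have d03 : cnorm (p v0 - p v3) = 2 / (1 + 4 * n).
  by apply: cnorm_eq; rewrite ?divr_ge0 ?ltW //= -r03; ring.
have d13 : cnorm (p v1 - p v3) = 2 / (1 + 4 * n).
  by apply: cnorm_eq; rewrite ?divr_ge0 ?ltW //= -r03; ring.
have d01 : cnorm (p v0 - p v1) = 2 / a.
  by apply: cnorm_eq; rewrite ?divr_ge0 ?ltW //=; ring.
have d23 : cnorm (p v2 - p v3) = 2 * c / b.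
  apply: cnorm_eq; first by apply: divr_ge0; lra.
  by rewrite /= /c; field.
have cn0 : c != 0 by rewrite gt_eqF.
move=> pm; exists p, m; split=> //; last by rewrite d02 divfK.
clear pm; exists 1; split=> // q _; apply: (@paw_minimum c m n) => //.
- by rewrite /c; lra.
- exact: ltW.
- exact: ltW.
- by rewrite mnE; apply: divr_ge0; lra.
- by rewrite d01 cE; field.
- by rewrite d02 divfK.
- by rewrite d12 divfK.
- by rewrite d03 divfK.
- by rewrite d13 divfK.
- by rewrite d23 mnE; field; rewrite bn0 cn0.
by move=> f [->|->] /=; ring.
Qed.

(** * Radical computation trees *)

Lemma rtree_eval_radical (t : rtree) (vals out : seq CC) : rtree_eval vals t out ->
  {in vals, forall x, radical x} -> {in out, forall x, radical x}.
Proof.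
(* An index beyond the list reads the default 0, which is radical. *)
have radical_nth (s : seq CC) i : {in s, forall x, radical x} -> radical s`_i.
  move=> rs; have [ilt|ige] := ltnP i (size s); first exact/rs/mem_nth.
  by rewrite nth_default //; apply: radical0.
elim=> {t vals out} [vals outs rv x /mapP[i _ ->]|vals o v t out ov _ IH rv|
    vals i t1 t2 out _ _ IH //|vals i t1 t2 out _ _ IH //]; first exact: radical_nth.
apply: IH => x; rewrite mem_rcons in_cons => /predU1P[->{x}|/rv//].
case: ov => [z|a b|a b|a b|a b _|k a y k0 ya|a].
- exact: radical_int.
- by apply: radicalD; apply: radical_nth.
- by apply: radicalB; apply: radical_nth.
- by apply: radicalM; apply: radical_nth.
- by apply: radicalM; [|apply: radicalV]; apply: radical_nth.
- by apply: (radical_root k0); rewrite ya; apply: radical_nth.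
exact: (radical_morph (conjc (R := RR))) (radical_nth _ _ rv).
Qed.

(** The square of the norm is [z] times its conjugate, and conjugation preserves radical numbers. *)
Lemma radical_cnorm (z : CC) : radical z -> radical ((cnorm z)%:C)%C.
Proof.
move=> rz; apply: (@radical_root _ 2) => //.
have -> : ((cnorm z)%:C)%C ^+ 2 = z * conjc z.
  case: z {rz} => a b; rewrite -rmorphXn /= sqr_sqrtr ?addr_ge0 ?sqr_ge0 //.
  by apply/eqP; rewrite eq_complex /=; apply/andP; split; apply/eqP; ring.
by apply: radicalM => //; apply: (radical_morph (conjc (R := RR))).
Qed.

Theorem theorem4 :
  exists e : rel 'I_4,
    simple_graph e /\ connected_graph e /\
    exists p : 'I_4 -> CC,
      kk_equilibrium e p /\
      forall (t : rtree) (q : 'I_4 -> CC),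
        congruent p q -> ~ rtree_constructs t q.
Proof.
exists paw; split; first exact: paw_simple.
split; first exact: paw_connected.
have [p [m [eq_p d02 pm]]] := paw_equilibrium; exists p; split=> // t q cong_pq.
case=> out [ev_t [sz_out q_out]].
have rq i : radical (q i).
  rewrite q_out; apply: (rtree_eval_radical ev_t) => //.
  by rewrite mem_nth // sz_out.
pose r := ((cnorm (q v0 - q v2))%:C)%C.
have rr : radical r by apply/radical_cnorm/radicalB.
(* The distance between [v0] and [v2] is [1 / (1 + m)] at [p], hence also at the congruent [q]; so
   [6 * m] is a field expression in a distance between radical points. *)
have mE : 6 * m = 6 * (cnorm (q v0 - q v2))^-1 - 6.
  have cn0 : cnorm (p v0 - p v2) != 0.
    by apply/eqP=> r0; move/eqP: d02; rewrite r0 mul0r eq_sym oner_eq0.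
  have -> : (cnorm (q v0 - q v2))^-1 = 1 + m.
    by apply: (mulfI cn0); rewrite cong_pq divff // d02.
  by ring.
apply: (@paw_root_not_radical _ ((6 * m)%:C)%C).
  by rewrite -(map_poly_intr (real_complex RR)) fmorph_root.
rewrite mE rmorphB rmorphM fmorphV.
have r6 : radical ((6 : RR)%:C)%C by rewrite rmorph_nat; apply: (radical_int _ 6).
by apply: radicalB => //; apply: radicalM => //; apply: radicalV.
Qed.
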